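(* Let $\ell$ be a field, let $E$ be a finite graph, let $L(E)$ be its Leavitt path algebra over $\ell$ with its canonical $\mathbb{Z}$-grading, and let $f:L(E)\to R$ be a $\mathbb{Z}$-graded $\ell$-algebra homomorphism. If $K_0^{\mathrm{gr}}(f)$ is a monomorphism, then $f$ is a monomorphism.
   Context: A graph $E$ has vertices $E^0$, edges $E^1$ and source/range maps $s,r:E^1\to E^0$; it is finite if $E^0$ and $E^1$ are finite. $L(E)$ is the $\ell$-algebra generated by $v\in E^0$, $e,e^*$ ($e\in E^1$) with relations $vw=\delta_{v,w}v$, $s(e)e=e=e\,r(e)$, $r(e)e^*=e^*=e^*s(e)$, $e^*f=\delta_{e,f}r(e)$, and $v=\sum_{s(e)=v}ee^*$ whenever $0<\#s^{-1}(v)<\infty$; its grading is $|v|=0$, $|e|=1$, $|e^*|=-1$. Algebras and homomorphisms need not be unital. For a unital $\mathbb{Z}$-graded ring $A$, $K_0^{\mathrm{gr}}(A)$ is the Grothendieck group of finitely generated projective $\mathbb{Z}$-graded right $A$-modules (with degree-preserving maps); for nonunital $A$, $K_0^{\mathrm{gr}}(A)=\ker(K_0^{\mathrm{gr}}(\tilde A_{\mathbb{Z}})\to K_0^{\mathrm{gr}}(\mathbb{Z}))$, where $\tilde A_{\mathbb{Z}}=A\oplus\mathbb{Z}$ is the unitalization, with $\mathbb{Z}$ in degree $0$. *)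

(* Defs.v *)
From HB Require Import structures.
From mathcomp Require Import all_boot all_order all_algebra.
From mathcomp Require Import ssrAC boolp classical_sets.

Set Implicit Arguments.
Unset Strict Implicit.
Unset Printing Implicit Defensive.

Import GRing.Theory.
Local Open Scope ring_scope.
Local Open Scope quotient_scope.

(* The isomorphism classes of modules form a type that lives above the
   universe of the carriers of [zmodType], so that K_0 cannot carry a
   [zmodType] structure; the few notions needed are set up by hand here.  An
   element of [quo R] is an equivalence class of R, as a predicate. *)

Record quo (T : Type) (R : T -> T -> Prop) :=
  Quo { quo_class : T -> Prop; quo_classP : exists x, quo_class = R x }.

Section Quo.
Variables (T : Type) (R : T -> T -> Prop).

Definition qpi (x : T) : quo R := Quo (ex_intro _ x erefl).

Definition qrepr (c : quo R) : T := proj1_sig (cid (quo_classP c)).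

Lemma qreprK c : qpi (qrepr c) = c.
Proof.
case: c => C HC; rewrite /qpi /qrepr /=; case: cid => x /= e.
move: HC; rewrite e => HC; congr Quo; exact: Prop_irrelevance.
Qed.

Hypotheses (Rr : forall x, R x x) (Rs : forall x y, R x y -> R y x)
  (Rt : forall x y z, R x y -> R y z -> R x z).

Lemma qpiE x y : qpi x = qpi y <-> R x y.
Proof.
split=> [[e]|xy]; first by rewrite e; apply: Rr.
rewrite /qpi.
have e : R x = R y.
  by apply/funext=> z; apply/propext; split; apply: Rt => //; apply: Rs.
move: (ex_intro _ x _) (ex_intro _ y _); rewrite e => p q.
congr Quo; exact: Prop_irrelevance.
Qed.

Lemma qreprE x : R (qrepr (qpi x)) x.
Proof. by apply/qpiE; rewrite qreprK. Qed.

End Quo.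

Record abMonoid := AbMonoid {
  abm_sort :> Type;
  abm0 : abm_sort;
  abmD : abm_sort -> abm_sort -> abm_sort;
  abmA : associative abmD;
  abmC : commutative abmD;
  abm0D : left_id abm0 abmD }.

Record abMonoidHom (M N : abMonoid) := AbMonoidHom {
  abmh_fun :> M -> N;
  abmh0 : abmh_fun (abm0 M) = abm0 N;
  abmhD : forall x y, abmh_fun (abmD x y) = abmD (abmh_fun x) (abmh_fun y) }.

Record abGroup := AbGroup {
  abg_sort :> Type;
  abg0 : abg_sort;
  abgD : abg_sort -> abg_sort -> abg_sort;
  abgN : abg_sort -> abg_sort;
  abgA : associative abgD;
  abgC : commutative abgD;
  abg0D : left_id abg0 abgD;
  abgND : left_inverse abg0 abgN abgD }.

Record abGroupHom (G H : abGroup) := AbGroupHom {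
  abgh_fun :> G -> H;
  abghD : forall x y, abgh_fun (abgD x y) = abgD (abgh_fun x) (abgh_fun y) }.

Section AbGroupTheory.

Lemma abgI (G : abGroup) (x y z : G) : abgD x y = abgD x z -> y = z.
Proof.
move=> /(congr1 (abgD (abgN x))).
by rewrite !abgA !abgND !abg0D.
Qed.

Lemma abgD0 (G : abGroup) (x : G) : abgD x (abg0 G) = x.
Proof. by rewrite abgC abg0D. Qed.

Lemma abgh0 (G H : abGroup) (h : abGroupHom G H) : h (abg0 G) = abg0 H.
Proof.
apply: (@abgI _ (h (abg0 G))).
by rewrite -abghD abg0D abgD0.
Qed.

Lemma abghN (G H : abGroup) (h : abGroupHom G H) x : h (abgN x) = abgN (h x).
Proof.
apply: (@abgI _ (h x)).
by rewrite -abghD ![abgD _ (abgN _)]abgC !abgND abgh0.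
Qed.

End AbGroupTheory.

Definition abGroupHom_id (G : abGroup) : abGroupHom G G :=
  @AbGroupHom G G id (fun _ _ => erefl).

Section Kernel.
Variables (G H : abGroup) (h : abGroupHom G H).

Record ker_type := Ker { ker_val : G; ker_valP : h ker_val = abg0 H }.

Lemma ker_val_inj : injective ker_val.
Proof.
case=> x hx [y hy] /= e; move: hx; rewrite e => hx.
congr Ker; exact: Prop_irrelevance.
Qed.

Fact ker0_subproof : h (abg0 G) = abg0 H. Proof. exact: abgh0. Qed.
Fact kerD_subproof (x y : ker_type) :
  h (abgD (ker_val x) (ker_val y)) = abg0 H.
Proof. by rewrite abghD !ker_valP abg0D. Qed.
Fact kerN_subproof (x : ker_type) : h (abgN (ker_val x)) = abg0 H.
Proof.
by rewrite abghN ker_valP -[LHS]abgD0 abgND.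
Qed.

Definition ker0 := Ker ker0_subproof.
Definition kerD x y := Ker (kerD_subproof x y).
Definition kerN x := Ker (kerN_subproof x).

Fact kerA : associative kerD.
Proof. by move=> x y z; apply: ker_val_inj; rewrite /= abgA. Qed.
Fact kerC : commutative kerD.
Proof. by move=> x y; apply: ker_val_inj; rewrite /= abgC. Qed.
Fact ker0D : left_id ker0 kerD.
Proof. by move=> x; apply: ker_val_inj; rewrite /= abg0D. Qed.
Fact kerND : left_inverse ker0 kerN kerD.
Proof. by move=> x; apply: ker_val_inj; rewrite /= abgND. Qed.

Definition kerGroup := AbGroup kerA kerC ker0D kerND.

End Kernel.

Section KernelMap.
Variables (G H G' H' : abGroup) (h : abGroupHom G H) (h' : abGroupHom G' H').
Variables (u : abGroupHom G G') (v : abGroupHom H H').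
Hypothesis uv : forall x, h' (u x) = v (h x).

Fact kerMap_subproof (x : kerGroup h) : h' (u (ker_val x)) = abg0 H'.
Proof. by rewrite uv ker_valP abgh0. Qed.

Definition kerMap_fun (x : kerGroup h) : kerGroup h' := Ker (kerMap_subproof x).

Fact kerMapD x y : kerMap_fun (abgD x y) = abgD (kerMap_fun x) (kerMap_fun y).
Proof. by apply: ker_val_inj; rewrite /= abghD. Qed.

Definition kerMap := AbGroupHom kerMapD.

End KernelMap.

Section Groth.
Variable M : abMonoid.
Local Notation "x +' y" := (@abmD M x y) (at level 50, left associativity).

(* the pair (a, b) stands for the formal difference a - b *)
Definition groth_rel (x y : M * M) : Prop :=
  exists s, x.1 +' y.2 +' s = y.1 +' x.2 +' s.

HB.instance Definition _ := Monoid.isComLaw.Build M (abm0 M) (@abmD M)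
  (@abmA M) (@abmC M) (@abm0D M).

Let abmAC (x y z : M) : x +' y +' z = x +' z +' y.
Proof. by rewrite -abmA [y +' z]abmC abmA. Qed.
Let abmACA (x y z t : M) : (x +' y) +' (z +' t) = (x +' z) +' (y +' t).
Proof. by rewrite !abmA [x +' y +' z]abmAC. Qed.

Fact groth_refl x : groth_rel x x. Proof. by exists (abm0 M). Qed.
Fact groth_sym x y : groth_rel x y -> groth_rel y x.
Proof. by case=> s e; exists s. Qed.
Fact groth_trans x y z : groth_rel x y -> groth_rel y z -> groth_rel x z.
Proof.
case: x y z => [a b] [c d] [e f] [s /= es] [t /= et].
exists (c +' d +' (s +' t)) => /=.
rewrite [LHS](AC (2*(2*2)) ((1*4*5)*(3*2*6))) /= es et.
by rewrite [LHS](AC (3*3) ((4*2)*((1*5)*(3*6)))).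
Qed.

Definition groth_type := quo groth_rel.

Definition groth_diff (a b : M) : groth_type := qpi groth_rel (a, b).

Lemma groth_diffE a b c d :
  groth_diff a b = groth_diff c d <-> exists s, a +' d +' s = c +' b +' s.
Proof. exact: (qpiE groth_refl groth_sym groth_trans). Qed.

Lemma grothP (x : groth_type) : exists a b, x = groth_diff a b.
Proof.
exists (qrepr x).1, (qrepr x).2.
by rewrite /groth_diff -surjective_pairing qreprK.
Qed.

Definition groth0 := groth_diff (abm0 M) (abm0 M).
Definition grothD (x y : groth_type) :=
  groth_diff ((qrepr x).1 +' (qrepr y).1) ((qrepr x).2 +' (qrepr y).2).
Definition grothN (x : groth_type) := groth_diff (qrepr x).2 (qrepr x).1.

Let reprE a b : groth_rel (qrepr (groth_diff a b)) (a, b).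
Proof. exact: (qreprE groth_refl groth_sym groth_trans). Qed.

Lemma grothDE a b c d :
  grothD (groth_diff a b) (groth_diff c d) = groth_diff (a +' c) (b +' d).
Proof.
apply/groth_diffE.
case: (reprE a b) (reprE c d) => s /= es [t /= et].
exists (s +' t).
rewrite [LHS](AC ((2*2)*2) ((1*3*5)*(2*4*6))) /= es et.
by rewrite [LHS](AC (3*3) ((1*4)*(2*5)*(3*6))).
Qed.

Lemma grothNE a b : grothN (groth_diff a b) = groth_diff b a.
Proof.
apply/groth_diffE; case: (reprE a b) => s /= es; exists s.
by rewrite [LHS](AC 3 (2*1*3)) /= -es [b +' _]abmC.
Qed.

Fact grothA : associative grothD.
Proof.
move=> x y z; have [[a [b ->]] [[c [d ->]] [e [f ->]]]] :=
  (grothP x, (grothP y, grothP z)).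
by rewrite !grothDE !abmA.
Qed.
Fact grothC : commutative grothD.
Proof.
move=> x y; have [[a [b ->]] [c [d ->]]] := (grothP x, grothP y).
by rewrite !grothDE [a +' c]abmC [b +' d]abmC.
Qed.
Fact groth0D : left_id groth0 grothD.
Proof.
by move=> x; have [a [b ->]] := grothP x; rewrite grothDE !abm0D.
Qed.
Fact grothND : left_inverse groth0 grothN grothD.
Proof.
move=> x; have [a [b ->]] := grothP x; rewrite grothNE grothDE.
by apply/groth_diffE; exists (abm0 M); rewrite !abm0D [b +' a]abmC abmC abm0D.
Qed.

Definition groth := AbGroup grothA grothC groth0D grothND.

End Groth.

Section GrothMap.
Variables (M N : abMonoid) (h : abMonoidHom M N).

Definition grothMap_fun (x : groth M) : groth N :=
  groth_diff (h (qrepr x).1) (h (qrepr x).2).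

Lemma grothMapE a b : grothMap_fun (groth_diff a b) = groth_diff (h a) (h b).
Proof.
apply/groth_diffE.
have [s /= es] := qreprE (@groth_refl M) (@groth_sym M) (@groth_trans M) (a, b).
by exists (h s); rewrite -!abmhD es.
Qed.

Fact grothMapD (x y : groth M) :
  grothMap_fun (abgD x y) = abgD (grothMap_fun x) (grothMap_fun y).
Proof.
have [[a [b ->]] [c [d ->]]] := (grothP x, grothP y).
by rewrite /= grothDE !grothMapE !abmhD -grothDE.
Qed.

Definition grothMap := AbGroupHom grothMapD.

End GrothMap.

(* M is the internal direct sum of the subgroups G n *)
Record is_grading (M : zmodType) (G : int -> set M) : Prop := IsGrading {
  grading0 : forall n, G n 0;
  gradingB : forall n x y, G n x -> G n y -> G n (x - y);
  grading_sum : forall x, exists (s : seq int) (c : int -> M),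
    [/\ uniq s, forall n, G n (c n) & x = \sum_(n <- s) c n];
  grading_free : forall (s : seq int) (c : int -> M),
    uniq s -> (forall n, G n (c n)) -> \sum_(n <- s) c n = 0 ->
    forall n, n \in s -> c n = 0 }.

Lemma big_seq_widen (M : zmodType) (c : int -> M) (s u : seq int) :
  uniq s -> uniq u -> {subset s <= u} -> (forall n, n \notin s -> c n = 0) ->
  \sum_(n <- s) c n = \sum_(n <- u) c n.
Proof.
move=> us uu su cs.
rewrite [RHS](bigID (mem s)) /= [X in _ + X]big1 ?addr0; last first.
  by move=> n /cs.
rewrite -[RHS]big_filter; apply: perm_big; apply: uniq_perm => //.
  by rewrite filter_uniq.
by move=> n; rewrite mem_filter andb_idr //; apply: su.
Qed.

Section GradingTheory.
Variables (M : zmodType) (G : int -> set M) (HG : is_grading G).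

Lemma gradingN n x : G n x -> G n (- x).
Proof. by move=> Gx; rewrite -sub0r; apply: gradingB => //; apply: grading0. Qed.

Lemma gradingD n x y : G n x -> G n y -> G n (x + y).
Proof.
by move=> Gx Gy; rewrite -[y]opprK; apply: gradingB => //; apply: gradingN.
Qed.

Lemma grading_bigsum n (I : Type) (r : seq I) (P : pred I) (F : I -> M) :
  (forall i, P i -> G n (F i)) -> G n (\sum_(i <- r | P i) F i).
Proof.
move=> GF; elim/big_ind: _ => //; first exact: grading0.
by move=> x y; apply: gradingD.
Qed.

Fact grading_comp_ex x : exists sc : seq int * (int -> M),
  [/\ uniq sc.1, forall n, G n (sc.2 n), forall n, n \notin sc.1 -> sc.2 n = 0
    & x = \sum_(n <- sc.1) sc.2 n].
Proof.
have [s [c [us Gc ->]]] := grading_sum HG x.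
exists (s, fun n => if n \in s then c n else 0); split=> //=.
- by move=> n; case: ifP => // _; apply: grading0.
- by move=> n /negbTE ->.
- by rewrite [LHS]big_seq [RHS]big_seq; apply: eq_bigr => n ->.
Qed.

Definition gsupp x : seq int := (proj1_sig (cid (grading_comp_ex x))).1.
Definition gcomp n x : M := (proj1_sig (cid (grading_comp_ex x))).2 n.

Lemma gsupp_uniq x : uniq (gsupp x).
Proof. by rewrite /gsupp; case: cid => ? []. Qed.
Lemma gcompP n x : G n (gcomp n x).
Proof. by rewrite /gcomp; case: cid => ? []. Qed.
Lemma gcomp_out n x : n \notin gsupp x -> gcomp n x = 0.
Proof. by rewrite /gcomp /gsupp; case: cid => ? [? ? H ?]; apply: H. Qed.
Lemma gcomp_sum x : x = \sum_(n <- gsupp x) gcomp n x.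
Proof. by rewrite /gcomp /gsupp; case: cid => ? []. Qed.

Lemma gcomp_uniq (s : seq int) (c : int -> M) x : uniq s ->
  (forall n, G n (c n)) -> (forall n, n \notin s -> c n = 0) ->
  x = \sum_(n <- s) c n -> forall n, gcomp n x = c n.
Proof.
move=> us Gc cs xE n.
pose u := undup (s ++ gsupp x).
have uu : uniq u by apply: undup_uniq.
have su : {subset s <= u} by move=> k ks; rewrite mem_undup mem_cat ks.
have xu : {subset gsupp x <= u}.
  by move=> k ks; rewrite mem_undup mem_cat ks orbT.
case: (boolP (n \in u)) => [nu|]; last first.
  rewrite mem_undup mem_cat negb_or => /andP[ns nx].
  by rewrite cs // gcomp_out.
apply/subr0_eq.
apply: (grading_free HG (c := fun n => gcomp n x - c n) uu) => //.
  by move=> k; apply: gradingB => //; apply: gcompP.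
rewrite sumrB -(big_seq_widen us uu su cs) -xE.
rewrite -(big_seq_widen (gsupp_uniq x) uu xu); first by rewrite -gcomp_sum subrr.
by move=> k; apply: gcomp_out.
Qed.

Lemma gcomp_id n x m : G n x -> gcomp m x = if m == n then x else 0.
Proof.
move=> Gx; apply: (@gcomp_uniq [:: n] (fun m => if m == n then x else 0)) => //.
- by move=> k; case: eqP => [->//|_]; apply: grading0.
- by move=> k; rewrite inE => /negbTE ->.
- by rewrite big_seq1 eqxx.
Qed.

Lemma gcompD n x y : gcomp n (x + y) = gcomp n x + gcomp n y.
Proof.
pose u := undup (gsupp x ++ gsupp y).
have uu : uniq u by apply: undup_uniq.
apply: (gcomp_uniq (s := u) (c := fun n => gcomp n x + gcomp n y)) => //.
- by move=> k; apply: gradingD; apply: gcompP.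
- move=> k; rewrite mem_undup mem_cat negb_or => /andP[? ?].
  by rewrite !gcomp_out ?addr0.
rewrite big_split /=; congr (_ + _).
  rewrite [LHS]gcomp_sum; apply: big_seq_widen => //; first exact: gsupp_uniq.
    by move=> k ks; rewrite mem_undup mem_cat ks.
  by move=> k; apply: gcomp_out.
rewrite [LHS]gcomp_sum; apply: big_seq_widen => //; first exact: gsupp_uniq.
  by move=> k ks; rewrite mem_undup mem_cat ks orbT.
by move=> k; apply: gcomp_out.
Qed.

Lemma grading_ind (Q : M -> Prop) : Q 0 ->
  (forall x y, Q x -> Q y -> Q (x + y)) -> (forall n x, G n x -> Q x) ->
  forall x, Q x.
Proof.
move=> Q0 QD QG x; rewrite [x]gcomp_sum; elim/big_ind: _ => // n _.
exact: QG (gcompP n x).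
Qed.

End GradingTheory.

Lemma grading_of_proj (M : zmodType) (G : int -> set M) (pr : int -> M -> M) :
  (forall n, G n 0) -> (forall n x y, G n x -> G n y -> G n (x - y)) ->
  (forall n x y, pr n (x + y) = pr n x + pr n y) ->
  (forall n x m, G n x -> pr m x = if m == n then x else 0) ->
  (forall Q : M -> Prop, Q 0 -> (forall x y, Q x -> Q y -> Q (x + y)) ->
    (forall n x, G n x -> Q x) -> forall x, Q x) ->
  is_grading G.
Proof.
move=> G0 GB prD prG Gspan.
have GD n x y : G n x -> G n y -> G n (x + y).
  by move=> Gx Gy; rewrite -[y]opprK; apply: (GB) => //; rewrite -sub0r; apply: GB.
have pr0 n : pr n 0 = 0 by rewrite (prG n 0 n (G0 n)) eqxx.
split=> //.
- pose Q x := exists (s : seq int) (c : int -> M), [/\ uniq s,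
    forall n, G n (c n), forall n, n \notin s -> c n = 0 & x = \sum_(n <- s) c n].
  suff H x : Q x by move=> x; have [s [c [? ? _ ?]]] := H x; exists s, c.
  apply: Gspan x.
  + by exists [::], (fun=> 0); rewrite big_nil.
  + move=> x y [s [c [us Gc cs xE]]] [t [d [ut Gd dt yE]]].
    pose u := undup (s ++ t).
    have uu : uniq u by apply: undup_uniq.
    exists u, (fun n => c n + d n); split=> //.
    * by move=> n; apply: GD.
    * move=> k; rewrite mem_undup mem_cat negb_or => /andP[? ?].
      by rewrite cs // dt // addr0.
    * rewrite big_split xE yE; congr (_ + _); apply: big_seq_widen => // k ks.
        by rewrite mem_undup mem_cat ks.
      by rewrite mem_undup mem_cat ks orbT.
  + move=> n x Gx; exists [:: n], (fun m => if m == n then x else 0); split=> //.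
    * by move=> m; case: eqP => [->|].
    * by move=> m; rewrite inE => /negbTE ->.
    * by rewrite big_seq1 eqxx.
- move=> s c us Gc c0 n ns; rewrite -(pr0 n) -c0.
  rewrite (big_morph (pr n) (prD n) (pr0 n)) (bigD1_seq n) //=.
  rewrite (prG n) // eqxx big1 ?addr0 // => m mn.
  by rewrite (prG m) // eq_sym (negbTE mn).
Qed.

Record gRing := MkGRing {
  gr_ring :> pzRingType;
  gr_deg : int -> set gr_ring;
  gr_grading : is_grading gr_deg;
  gr_deg1 : gr_deg 0 1;
  gr_degM : forall m n a b, gr_deg m a -> gr_deg n b -> gr_deg (m + n) (a * b) }.
Arguments gr_deg {g}.

Record gRingHom (A B : gRing) := GRingHom {
  grh_fun :> {rmorphism A -> B};
  grh_deg : forall n a, gr_deg n a -> gr_deg n (grh_fun a) }.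

(* Right A-modules are left modules over the converse ring A^c: for M of type
   [lmodType A^c], x in M and a in A, the element x a is written a *: x, and
   a *: (b *: x) = (b * a) *: x. *)
Record gModule (A : gRing) := GModule {
  gm_mod :> lmodType A^c;
  gm_deg : int -> set gm_mod;
  gm_grading : is_grading gm_deg;
  gm_degZ : forall m n (x : gm_mod) (a : A),
    gm_deg m x -> gr_deg n a -> gm_deg (m + n) ((a : A^c) *: x) }.
Arguments gm_deg {A g}.

Lemma rscalerA (A : gRing) (M : gModule A) (a b : A) (x : M) :
  (a : A^c) *: ((b : A^c) *: x) = ((b * a : A) : A^c) *: x.
Proof. exact: scalerA. Qed.

Record gModHom (A : gRing) (M N : gModule A) := GModHom {
  gmh_fun :> {linear M -> N};
  gmh_deg : forall n x, gm_deg n x -> gm_deg n (gmh_fun x) }.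

Definition gmod_iso (A : gRing) (M N : gModule A) : Prop :=
  exists (g : gModHom M N) (h : gModHom N M), cancel g h /\ cancel h g.

Definition finitely_generated (A : gRing) (M : gModule A) : Prop :=
  exists (n : nat) (g : 'I_n -> M),
    forall x : M, exists a : 'I_n -> A, x = \sum_i (a i : A^c) *: g i.

(* projectivity in the category of graded modules and degree-preserving maps
   (for a graded module, the same as projectivity of the underlying module) *)
Definition gprojective (A : gRing) (P : gModule A) : Prop :=
  forall (M N : gModule A) (g : gModHom M N) (h : gModHom P N),
    (forall y, exists x, g x = y) ->
    exists k : gModHom P M, forall x, g (k x) = h x.

Record fgpModule (A : gRing) := FgpModule {
  fgp_mod :> gModule A;
  fgp_fg : finitely_generated fgp_mod;
  fgp_proj : gprojective fgp_mod }.
Arguments fgp_proj {A} f : rename.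

Section MakeHom.
Variables (A : gRing) (M N : gModule A) (f : M -> N).
Hypotheses (fD : forall x y, f (x + y) = f x + f y)
  (fZ : forall (a : A) (x : M), f ((a : A^c) *: x) = (a : A^c) *: f x)
  (fdeg : forall n x, gm_deg n x -> gm_deg n (f x)).

Definition mkhom_fun := f.

Fact mkhom_linear : linear mkhom_fun.
Proof. by move=> a x y; rewrite /mkhom_fun fD fZ. Qed.

HB.instance Definition _ := GRing.isLinear.Build A^c M N _ mkhom_fun mkhom_linear.

Definition mkhom : gModHom M N := @GModHom A M N mkhom_fun fdeg.

Lemma mkhomE x : mkhom x = f x. Proof. by []. Qed.

End MakeHom.

Section HomOps.
Variables (A : gRing).

Definition gmh_id (M : gModule A) : gModHom M M :=
  @mkhom A M M id (fun _ _ => erefl) (fun _ _ => erefl) (fun _ _ H => H).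

Definition gmh_comp (M N P : gModule A) (g : gModHom N P) (f : gModHom M N) :
  gModHom M P.
Proof.
apply: (@mkhom A M P (fun x => g (f x))).
- by move=> x y; rewrite !raddfD.
- by move=> a x; rewrite !linearZ.
- by move=> n x Hx; do 2!apply: gmh_deg.
Defined.

Lemma gmod_iso_refl (M : gModule A) : gmod_iso M M.
Proof. by exists (gmh_id M), (gmh_id M). Qed.

Lemma gmod_iso_sym (M N : gModule A) : gmod_iso M N -> gmod_iso N M.
Proof. by case=> g [h [? ?]]; exists h, g. Qed.

Lemma gmod_iso_trans (M N P : gModule A) :
  gmod_iso M N -> gmod_iso N P -> gmod_iso M P.
Proof.
case=> g [h [gh hg]] [g' [h' [gh' hg']]].
exists (gmh_comp g' g), (gmh_comp h h'); split=> x /=.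
  by rewrite /mkhom_fun gh' gh.
by rewrite /mkhom_fun hg hg'.
Qed.

End HomOps.

Section ZeroSum.
Variable A : gRing.

Definition gzero_mod : lmodType A^c := 'rV[A^c]_0.

Fact gzero_eq (x y : gzero_mod) : x = y.
Proof. by apply/matrixP => i []. Qed.

Fact gzero_grading : is_grading (fun _ : int => [set: gzero_mod]%classic).
Proof.
split=> //; last by move=> *; apply: gzero_eq.
move=> x; exists [::], (fun=> 0); split=> //; exact: gzero_eq.
Qed.

Definition gzero : gModule A :=
  @GModule A gzero_mod _ gzero_grading (fun _ _ _ _ _ _ => I).

Lemma gzero_fg : finitely_generated gzero.
Proof.
exists 0, (fun=> 0) => x; exists (fun=> 0); exact: gzero_eq.
Qed.

Lemma gzero_proj : gprojective gzero.
Proof.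
move=> M N g h _.
have k0 : forall n (x : gzero), gm_deg n x -> gm_deg n (0 : M).
  by move=> n x _; apply: grading0 (gm_grading M) n.
exists (@mkhom A gzero M (fun=> 0) (fun _ _ => esym (addr0 _))
  (fun a _ => esym (scaler0 _ _)) k0) => x.
by rewrite mkhomE raddf0 (gzero_eq x 0) raddf0.
Qed.

Definition fgp0 : fgpModule A := FgpModule gzero_fg gzero_proj.

Section Sum.
Variables M N : gModule A.

Definition gsum_deg (n : int) : set (M * N)%type :=
  [set x | gm_deg n x.1 /\ gm_deg n x.2]%classic.

Fact gsum_grading : is_grading gsum_deg.
Proof.
have [HM HN] := (gm_grading M, gm_grading N).
apply: (@grading_of_proj _ _
  (fun n (x : M * N) => (gcomp HM n x.1, gcomp HN n x.2) : (M * N)%type)).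
- by move=> n; split; apply: grading0.
- by move=> n x y [? ?] [? ?]; split; apply: gradingB.
- by move=> n x y /=; rewrite !gcompD.
- move=> n [x y] m [/= Hx Hy]; rewrite (gcomp_id HM m Hx) (gcomp_id HN m Hy).
  by case: eqP.
- move=> Q Q0 QD QG [x y].
  have -> : (x, y) = (x, 0) + (0, y).
    by congr pair; rewrite /= ?addr0 ?add0r.
  apply: (QD).
    apply: (grading_ind HM (Q := fun x => Q (x, 0))) => [|{}x x' Qx Qx'|n {}x Hx]; first exact: Q0.
      have -> : (x + x', 0) = (x, 0) + (x', 0) :> M * N.
        by congr pair; rewrite /= ?addr0.
      exact: QD.
    by apply: (QG n); split=> //; apply: grading0 HN n.
  apply: (grading_ind HN (Q := fun y => Q (0, y))) => [|{}y y' Qy Qy'|n {}y Hy]; first exact: Q0.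
    have -> : (0, y + y') = (0, y) + (0, y') :> M * N.
      by congr pair; rewrite /= ?addr0.
    exact: QD.
  by apply: (QG n); split=> //; apply: grading0 HM n.
Qed.

Fact gsum_degZ m n (x : (M * N)%type) (a : A) :
  gsum_deg m x -> gr_deg n a -> gsum_deg (m + n) ((a : A^c) *: x).
Proof. by case=> ? ? ?; split; apply: gm_degZ. Qed.

Definition gsum : gModule A := @GModule A (M * N)%type _ gsum_grading gsum_degZ.

Definition gsum_inl : gModHom M gsum.
Proof.
apply: (@mkhom A M gsum (fun x => (x, 0))).
- by move=> x y; congr pair; rewrite /= addr0.
- by move=> a x; congr pair; rewrite /= scaler0.
- by move=> n x Hx; split=> //; apply: grading0 (gm_grading N) n.
Defined.

Definition gsum_inr : gModHom N gsum.
Proof.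
apply: (@mkhom A N gsum (fun x => (0, x))).
- by move=> x y; congr pair; rewrite /= addr0.
- by move=> a x; congr pair; rewrite /= scaler0.
- by move=> n x Hx; split=> //; apply: grading0 (gm_grading M) n.
Defined.

Definition gsum_pair (P : gModule A) (f : gModHom M P) (g : gModHom N P) :
  gModHom gsum P.
Proof.
apply: (@mkhom A gsum P (fun x => f x.1 + g x.2)).
- by move=> x y; rewrite /= !raddfD addrACA.
- by move=> a x; rewrite /= !linearZ scalerDr.
- by move=> n x [? ?]; apply: (gradingD (gm_grading P)); apply: gmh_deg.
Defined.

Lemma gsum_fg :
  finitely_generated M -> finitely_generated N -> finitely_generated gsum.
Proof.
move=> [m [g gP]] [n [h hP]].
exists (m + n)%N, (fun i => match split i with
  | inl j => (g j, 0) | inr k => (0, h k) end) => -[x y].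
have [a xE] := gP x; have [b yE] := hP y.
exists (fun i => match split i with inl j => a j | inr k => b k end).
rewrite big_split_ord /=.
under eq_bigr => i _ do rewrite (unsplitK (inl i)).
under [X in _ + X]eq_bigr => i _ do rewrite (unsplitK (inr i)).
have E1 (F : 'I_m -> M) : \sum_i ((F i, 0) : M * N) = (\sum_i F i, 0).
  by elim/big_rec2: _ => // i u v _ ->; congr pair; rewrite /= ?addr0.
have E2 (F : 'I_n -> N) : \sum_i ((0, F i) : M * N) = (0, \sum_i F i).
  by elim/big_rec2: _ => // i u v _ ->; congr pair; rewrite /= ?addr0.
transitivity ((\sum_i (a i : A^c) *: g i, 0) + (0, \sum_i (b i : A^c) *: h i)
   : (M * N)%type).
  by rewrite -xE -yE; congr pair; rewrite /= ?addr0 ?add0r.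
rewrite -E1 -E2; congr (_ + _); apply: eq_bigr => i _; congr pair;
  by rewrite /= scaler0.
Qed.

Lemma gsum_proj : gprojective M -> gprojective N -> gprojective gsum.
Proof.
move=> pM pN P Q g h gs.
have [k kP] := pM P Q g (gmh_comp h gsum_inl) gs.
have [l lP] := pN P Q g (gmh_comp h gsum_inr) gs.
exists (gsum_pair k l) => -[x y]; change (g (k x + l y) = h (x, y)).
transitivity (g (k x) + g (l y)); first exact: raddfD.
rewrite kP lP; change (h (x, 0) + h (0, y) = h (x, y)).
by rewrite -raddfD; congr (h _); congr pair; rewrite /= ?addr0 ?add0r.
Qed.

End Sum.

Definition fgpD (P Q : fgpModule A) : fgpModule A :=
  FgpModule (gsum_fg (fgp_fg P) (fgp_fg Q)) (gsum_proj (fgp_proj P) (fgp_proj Q)).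

Section SumIso.
Variables M M' N N' P : gModule A.

Lemma gsum_iso : gmod_iso M M' -> gmod_iso N N' ->
  gmod_iso (gsum M N) (gsum M' N').
Proof.
case=> f [f' [ff' f'f]] [g [g' [gg' g'g]]].
exists (gsum_pair (gmh_comp (gsum_inl _ _) f) (gmh_comp (gsum_inr _ _) g)).
exists (gsum_pair (gmh_comp (gsum_inl _ _) f') (gmh_comp (gsum_inr _ _) g')).
by split=> -[x y]; congr pair; rewrite /= /mkhom_fun /= ?addr0 ?add0r.
Qed.

Lemma gsum_isoC : gmod_iso (gsum M N) (gsum N M).
Proof.
exists (gsum_pair (gsum_inr _ _) (gsum_inl _ _)).
exists (gsum_pair (gsum_inr _ _) (gsum_inl _ _)).
by split=> -[x y]; congr pair; rewrite /= /mkhom_fun /= ?addr0 ?add0r.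
Qed.

Lemma gsum_iso0 : gmod_iso (gsum gzero M) M.
Proof.
have k0 : forall n (x : gzero), gm_deg n x -> gm_deg n (0 : M).
  by move=> n x _; apply: grading0 (gm_grading M) n.
pose z := @mkhom A gzero M (fun=> 0) (fun _ _ => esym (addr0 _))
  (fun a _ => esym (scaler0 _ _)) k0.
exists (gsum_pair z (gmh_id _)), (gsum_inr _ _).
split=> [[x y]|x].
  by congr pair; rewrite /= /mkhom_fun /= ?add0r //; apply: gzero_eq.
by rewrite /= /mkhom_fun /= add0r.
Qed.

Lemma gsum_isoA : gmod_iso (gsum M (gsum N P)) (gsum (gsum M N) P).
Proof.
exists (gsum_pair (gmh_comp (gsum_inl _ _) (gsum_inl _ _))
  (gsum_pair (gmh_comp (gsum_inl _ _) (gsum_inr _ _)) (gsum_inr _ _))).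
exists (gsum_pair (gsum_pair (gsum_inl _ _) (gmh_comp (gsum_inr _ _) (gsum_inl _ _)))
  (gmh_comp (gsum_inr _ _) (gsum_inr _ _))).
split=> [[x [y z]]|[[x y] z]].
  by congr (_, (_, _)); rewrite /= /mkhom_fun /= ?addr0 ?add0r.
by congr (_, _, _); rewrite /= /mkhom_fun /= ?addr0 ?add0r.
Qed.

End SumIso.

Definition fgp_iso (P Q : fgpModule A) : Prop := gmod_iso P Q.

Fact fgp_iso_refl P : fgp_iso P P. Proof. exact: gmod_iso_refl. Qed.
Fact fgp_iso_sym P Q : fgp_iso P Q -> fgp_iso Q P.
Proof. exact: gmod_iso_sym. Qed.
Fact fgp_iso_trans P Q R : fgp_iso P Q -> fgp_iso Q R -> fgp_iso P R.
Proof. exact: gmod_iso_trans. Qed.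

Definition Vgr_type := quo fgp_iso.

Definition Vclass (P : fgpModule A) : Vgr_type := qpi fgp_iso P.

Lemma VclassE P Q : Vclass P = Vclass Q <-> gmod_iso P Q.
Proof. exact: (qpiE fgp_iso_refl fgp_iso_sym fgp_iso_trans). Qed.

Lemma VclassP (x : Vgr_type) : exists P, x = Vclass P.
Proof. by exists (qrepr x); rewrite /Vclass qreprK. Qed.

Lemma qrepr_Vclass P : gmod_iso (qrepr (Vclass P)) P.
Proof. exact: (qreprE fgp_iso_refl fgp_iso_sym fgp_iso_trans). Qed.

Definition VgrD (x y : Vgr_type) : Vgr_type :=
  Vclass (fgpD (qrepr x) (qrepr y)).

Lemma VgrDE P Q : VgrD (Vclass P) (Vclass Q) = Vclass (fgpD P Q).
Proof. by apply/VclassE; apply: gsum_iso; apply: qrepr_Vclass. Qed.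

Fact VgrA : associative VgrD.
Proof.
move=> x y z; have [[P ->] [[Q ->] [S ->]]] := (VclassP x, (VclassP y, VclassP z)).
by rewrite !VgrDE; apply/VclassE; apply: gsum_isoA.
Qed.
Fact VgrC : commutative VgrD.
Proof.
move=> x y; have [[P ->] [Q ->]] := (VclassP x, VclassP y).
by rewrite !VgrDE; apply/VclassE; apply: gsum_isoC.
Qed.
Fact Vgr0D : left_id (Vclass fgp0) VgrD.
Proof.
by move=> x; have [P ->] := VclassP x; rewrite VgrDE; apply/VclassE/gsum_iso0.
Qed.

Definition Vgr := AbMonoid VgrA VgrC Vgr0D.

End ZeroSum.

Definition K0gr (A : gRing) : abGroup := groth (Vgr A).

Section Restriction.
Variables (A B : gRing) (f : gRingHom A B) (N : gModule B).

Definition restr_type : Type := N.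
HB.instance Definition _ := GRing.Zmodule.on restr_type.

Definition restr_scale (a : A^c) (x : restr_type) : restr_type :=
  (f a : B^c) *: (x : N).

Fact restr_scaleA a b x :
  restr_scale a (restr_scale b x) = restr_scale (a * b) x.
Proof. by rewrite /restr_scale scalerA [f (a * b)](rmorphM f (b : A) (a : A)). Qed.
Fact restr_scale1 : left_id 1 restr_scale.
Proof. by move=> x; rewrite /restr_scale [f 1](rmorph1 f) scale1r. Qed.
Fact restr_scaleDr : right_distributive restr_scale +%R.
Proof. by move=> a x y; rewrite /restr_scale scalerDr. Qed.
Fact restr_scaleDl x : {morph restr_scale^~ x : a b / a + b}.
Proof.
by move=> a b; rewrite /restr_scale [f (a + b)](raddfD f (a : A) (b : A)) scalerDl.
Qed.

HB.instance Definition _ := GRing.Zmodule_isLmodule.Build A^c restr_type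
  restr_scaleA restr_scale1 restr_scaleDr restr_scaleDl.

Definition restr_deg (n : int) : set restr_type := @gm_deg B N n.

Fact restr_degZ m n (x : restr_type) (a : A) :
  restr_deg m x -> gr_deg n a -> restr_deg (m + n) ((a : A^c) *: x).
Proof. by move=> Hx Ha; apply: (@gm_degZ B N) => //; apply: grh_deg. Qed.

Definition grestr : gModule A :=
  @GModule A restr_type restr_deg (gm_grading N) restr_degZ.

End Restriction.

Section Tensor.
Variables (A B : gRing) (f : gRingHom A B) (P : gModule A).

Record balanced (N : zmodType) (beta : P -> B -> N) : Prop := Balanced {
  balDl : forall p q b, beta (p + q) b = beta p b + beta q b;
  balDr : forall p b c, beta p (b + c) = beta p b + beta p c;
  balA : forall p a b, beta ((a : A^c) *: p) b = beta p (f a * b) }.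

Definition tens_eval (N : zmodType) (beta : P -> B -> N) (s : seq (P * B)) : N :=
  \sum_(x <- s) beta x.1 x.2.

(* P (x)_A B consists of the finite formal sums of pairs (p, b), two of them
   being identified when no balanced map separates them. *)
Definition tens_rel (s t : seq (P * B)) : bool :=
  `[< forall (N : zmodType) (beta : P -> B -> N), balanced beta ->
      tens_eval beta s = tens_eval beta t >].

Fact tens_rel_refl : reflexive tens_rel.
Proof. by move=> s; apply/asboolP. Qed.
Fact tens_rel_sym : symmetric tens_rel.
Proof.
by move=> s t; apply/asboolP/asboolP => H N beta Hb; rewrite H.
Qed.
Fact tens_rel_trans : transitive tens_rel.
Proof.
move=> s t u /asboolP H /asboolP H'; apply/asboolP => N beta Hb.
by rewrite H // H'.
Qed.

Canonical tens_equiv := EquivRel tens_rel tens_rel_refl tens_rel_sym tens_rel_trans.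

Definition tensor := {eq_quot tens_equiv}.
HB.instance Definition _ := Choice.on tensor.
HB.instance Definition _ := EqQuotient.on tensor.

Implicit Types (s t : seq (P * B)).

Lemma tens_eqP s t : \pi_tensor s = \pi_tensor t <->
  forall (N : zmodType) (beta : P -> B -> N), balanced beta ->
    tens_eval beta s = tens_eval beta t.
Proof.
split=> [/eqP|H]; first by rewrite eqmodE => /asboolP.
by apply/eqP; rewrite eqmodE; apply/asboolP.
Qed.

Lemma tens_eval_repr s (N : zmodType) (beta : P -> B -> N) : balanced beta ->
  tens_eval beta (repr (\pi_tensor s)) = tens_eval beta s.
Proof. by move=> Hb; apply: (tens_eqP _ _).1 => //; rewrite reprK. Qed.

Lemma tensorP (x : tensor) : exists s, x = \pi_tensor s.
Proof. by exists (repr x); rewrite reprK. Qed.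

Lemma tens_eval_cat (N : zmodType) (beta : P -> B -> N) s t :
  tens_eval beta (s ++ t) = tens_eval beta s + tens_eval beta t.
Proof. by rewrite /tens_eval big_cat. Qed.

Lemma bal0l (N : zmodType) (beta : P -> B -> N) b : balanced beta -> beta 0 b = 0.
Proof.
move=> Hb; apply: (addrI (beta 0 b)).
by rewrite -(balDl Hb) !addr0.
Qed.

Lemma bal0r (N : zmodType) (beta : P -> B -> N) p : balanced beta -> beta p 0 = 0.
Proof.
move=> Hb; apply: (addrI (beta p 0)).
by rewrite -(balDr Hb) !addr0.
Qed.

Lemma balNl (N : zmodType) (beta : P -> B -> N) p b :
  balanced beta -> beta (- p) b = - beta p b.
Proof.
move=> Hb; apply/eqP; rewrite -subr_eq0 opprK -(balDl Hb) addNr.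
by rewrite bal0l.
Qed.

Definition tens0 : tensor := \pi_tensor [::].
Definition tensD (x y : tensor) : tensor := \pi_tensor (repr x ++ repr y).
Definition tensN (x : tensor) : tensor :=
  \pi_tensor [seq (- u.1, u.2) | u <- repr x].

Lemma tens_eval_opp (N : zmodType) (beta : P -> B -> N) s : balanced beta ->
  tens_eval beta [seq (- u.1, u.2) | u <- s] = - tens_eval beta s.
Proof.
move=> Hb; rewrite /tens_eval big_map -sumrN; apply: eq_bigr => x _ /=.
exact: balNl.
Qed.

Lemma tensDE s t : tensD (\pi_tensor s) (\pi_tensor t) = \pi_tensor (s ++ t).
Proof.
by apply/tens_eqP => N beta Hb; rewrite !tens_eval_cat !tens_eval_repr.
Qed.

Lemma tensNE s : tensN (\pi_tensor s) = \pi_tensor [seq (- u.1, u.2) | u <- s].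
Proof.
by apply/tens_eqP => N beta Hb; rewrite !tens_eval_opp // tens_eval_repr.
Qed.

Fact tensA : associative tensD.
Proof.
move=> x y z; have [[s ->] [[t ->] [u ->]]] := (tensorP x, (tensorP y, tensorP z)).
by rewrite !tensDE catA.
Qed.
Fact tensC : commutative tensD.
Proof.
move=> x y; have [[s ->] [t ->]] := (tensorP x, tensorP y).
rewrite !tensDE; apply/tens_eqP => N beta Hb.
by rewrite !tens_eval_cat addrC.
Qed.
Fact tens0D : left_id tens0 tensD.
Proof. by move=> x; have [s ->] := tensorP x; rewrite tensDE. Qed.
Fact tensND : left_inverse tens0 tensN tensD.
Proof.
move=> x; have [s ->] := tensorP x; rewrite tensNE tensDE.
apply/tens_eqP => N beta Hb.
by rewrite tens_eval_cat tens_eval_opp // addNr /tens_eval big_nil.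
Qed.

HB.instance Definition _ :=
  GRing.isZmodule.Build tensor tensA tensC tens0D tensND.

Definition tens (p : P) (b : B) : tensor := \pi_tensor [:: (p, b)].

Lemma tens_balanced : balanced tens.
Proof.
split=> [p q b|p b c|p a b]; rewrite /tens.
- rewrite [RHS]tensDE; apply/tens_eqP => N beta Hb.
  by rewrite /tens_eval !big_cons !big_nil /= !addr0 (balDl Hb).
- rewrite [RHS]tensDE; apply/tens_eqP => N beta Hb.
  by rewrite /tens_eval !big_cons !big_nil /= !addr0 (balDr Hb).
- apply/tens_eqP => N beta Hb.
  by rewrite /tens_eval !big_cons !big_nil /= !addr0 (balA Hb).
Qed.

Definition tens_lift (N : zmodType) (beta : P -> B -> N) (x : tensor) : N :=
  tens_eval beta (repr x).

Section Lift.
Variables (N : zmodType) (beta : P -> B -> N).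
Hypothesis Hb : balanced beta.

Lemma tens_liftE p b : tens_lift beta (tens p b) = beta p b.
Proof.
by rewrite /tens_lift tens_eval_repr // /tens_eval big_cons big_nil /= addr0.
Qed.

Lemma tens_liftD x y : tens_lift beta (x + y) = tens_lift beta x + tens_lift beta y.
Proof.
have [[s ->] [t ->]] := (tensorP x, tensorP y).
by rewrite [_ + _]tensDE /tens_lift !tens_eval_repr // tens_eval_cat.
Qed.

Lemma tens_lift0 : tens_lift beta 0 = 0.
Proof. by rewrite /tens_lift tens_eval_repr // /tens_eval big_nil. Qed.

End Lift.

Lemma tens_ind (Q : tensor -> Prop) : Q 0 ->
  (forall x y, Q x -> Q y -> Q (x + y)) -> (forall p b, Q (tens p b)) ->
  forall x, Q x.
Proof.
move=> Q0 QD Qt x; have [s ->] := tensorP x.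
elim: s => [|[p b] s IH]; first exact: Q0.
have -> : \pi_tensor ((p, b) :: s) = tens p b + \pi_tensor s :> tensor.
  by rewrite [RHS]tensDE.
exact: QD.
Qed.

Definition tens_scale (c : B^c) : tensor -> tensor :=
  tens_lift (fun p b => tens p (b * (c : B))).

Fact tens_scale_balanced (c : B) : balanced (fun p b => tens p (b * c)).
Proof.
have [Dl Dr bA] := tens_balanced.
by split=> [p q b|p b d|p a b] /=; rewrite ?mulrDl ?Dl ?Dr ?bA ?mulrA.
Qed.

Lemma tens_scaleE (c : B) p b : tens_scale c (tens p b) = tens p (b * c).
Proof. exact: (tens_liftE (tens_scale_balanced c)). Qed.
Lemma tens_scaleD (c : B) x y :
  tens_scale c (x + y) = tens_scale c x + tens_scale c y.
Proof. exact: (tens_liftD (tens_scale_balanced c)). Qed.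
Lemma tens_scale0 (c : B) : tens_scale c 0 = 0.
Proof. exact: (tens_lift0 (tens_scale_balanced c)). Qed.

Fact tens_scaleA (a b : B^c) x :
  tens_scale a (tens_scale b x) = tens_scale (a * b) x.
Proof.
elim/tens_ind: x => [|x y Hx Hy|p c]; first by rewrite !tens_scale0.
  by rewrite !tens_scaleD Hx Hy.
by rewrite !tens_scaleE; congr tens; rewrite -mulrA.
Qed.
Fact tens_scale1 : left_id 1 tens_scale.
Proof.
move=> x; elim/tens_ind: x => [|x y Hx Hy|p c]; first by rewrite !tens_scale0.
  by rewrite !tens_scaleD Hx Hy.
by rewrite [LHS]tens_scaleE mulr1.
Qed.
Fact tens_scaleDr : right_distributive tens_scale +%R.
Proof. by move=> c x y; rewrite tens_scaleD. Qed.
Fact tens_scaleDl x : {morph tens_scale^~ x : a b / a + b}.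
Proof.
move=> a b; elim/tens_ind: x => [|x y Hx Hy|p c]; first by rewrite !tens_scale0 addr0.
  by rewrite !tens_scaleD Hx Hy addrACA.
rewrite [LHS]tens_scaleE [in RHS]tens_scaleE [in RHS]tens_scaleE mulrDr.
exact: (balDr tens_balanced).
Qed.

HB.instance Definition _ := GRing.Zmodule_isLmodule.Build B^c tensor
  tens_scaleA tens_scale1 tens_scaleDr tens_scaleDl.

Definition tens_deg (n : int) : set tensor := [set x | exists s : seq (P * B),
  x = \sum_(u <- s) tens u.1 u.2 /\
  forall u, u \in s -> exists i j,
    [/\ i + j = n, gm_deg i u.1 & gr_deg j u.2]]%classic.

Let HP := gm_grading P.
Let HB := gr_grading B.

Definition tens_proj_bal n p b : tensor :=
  \sum_(i <- gsupp HP p) tens (gcomp HP i p) (gcomp HB (n - i) b).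

Lemma tens_proj_widen n p b (u : seq int) : uniq u -> {subset gsupp HP p <= u} ->
  tens_proj_bal n p b = \sum_(i <- u) tens (gcomp HP i p) (gcomp HB (n - i) b).
Proof.
move=> uu pu; apply: (big_seq_widen (gsupp_uniq HP p) uu pu) => i Hi.
by rewrite gcomp_out // (bal0l _ tens_balanced).
Qed.

Fact tens_projDl n p q b :
  tens_proj_bal n (p + q) b = tens_proj_bal n p b + tens_proj_bal n q b.
Proof.
pose u := undup (gsupp HP p ++ gsupp HP q ++ gsupp HP (p + q)).
have uu : uniq u by apply: undup_uniq.
rewrite !(@tens_proj_widen _ _ _ u) //;
  try by move=> i Hi; rewrite mem_undup !mem_cat Hi ?orbT.
rewrite -big_split; apply: eq_bigr => i _.
by rewrite gcompD (balDl tens_balanced).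
Qed.

Fact tens_projDr n p b c :
  tens_proj_bal n p (b + c) = tens_proj_bal n p b + tens_proj_bal n p c.
Proof.
rewrite -big_split; apply: eq_bigr => i _.
by rewrite gcompD (balDr tens_balanced).
Qed.

Lemma tens_projE n i p b : gm_deg i p ->
  tens_proj_bal n p b = tens p (gcomp HB (n - i) b).
Proof.
move=> Hp; pose u := undup (i :: gsupp HP p).
have uu : uniq u by apply: undup_uniq.
rewrite (@tens_proj_widen _ _ _ u) //; last first.
  by move=> j Hj; rewrite mem_undup inE Hj orbT.
rewrite (bigD1_seq i) //=; last by rewrite mem_undup inE eqxx.
rewrite (gcomp_id HP i Hp) eqxx big1 ?addr0 // => j ji.
by rewrite (gcomp_id HP j Hp) (negbTE ji) (bal0l _ tens_balanced).
Qed.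

Lemma tens_projEE n i j p b : gm_deg i p -> gr_deg j b ->
  tens_proj_bal n p b = if n == i + j then tens p b else 0.
Proof.
move=> Hp Hb; rewrite (tens_projE _ _ Hp) (gcomp_id HB (n - i) Hb).
rewrite subr_eq [j + i]addrC; case: eqP => // _.
exact: (bal0r _ tens_balanced).
Qed.

Lemma tens_proj0l n b : tens_proj_bal n 0 b = 0.
Proof. by apply: (addrI (tens_proj_bal n 0 b)); rewrite -tens_projDl !addr0. Qed.
Lemma tens_proj0r n p : tens_proj_bal n p 0 = 0.
Proof. by apply: (addrI (tens_proj_bal n p 0)); rewrite -tens_projDr !addr0. Qed.

Fact tens_proj_balanced n : balanced (tens_proj_bal n).
Proof.
split=> [p q b|p b c|p a b]; [exact: tens_projDl|exact: tens_projDr|].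
move: p; apply: (grading_ind HP) => [|p q Hp Hq|i p Hp].
- by rewrite scaler0 !tens_proj0l.
- by rewrite scalerDr !tens_projDl Hp Hq.
move: a; apply: (grading_ind (gr_grading A)) => [|a a' Ha Ha'|j a Ha].
- by rewrite [_ *: p]scale0r rmorph0 mul0r tens_proj0l tens_proj0r.
- rewrite [_ *: p]scalerDl tens_projDl Ha Ha' rmorphD mulrDl.
  by rewrite tens_projDr.
move: b; apply: (grading_ind HB) => [|b b' Hb Hb'|k b Hb].
- by rewrite mulr0 !tens_proj0r.
- by rewrite mulrDr !tens_projDr Hb Hb'.
rewrite (tens_projEE n (gm_degZ Hp Ha) Hb).
rewrite (tens_projEE n Hp (gr_degM (grh_deg f Ha) Hb)) addrA.
by case: eqP => // _; apply: (balA tens_balanced).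
Qed.

Definition tens_proj n : tensor -> tensor := tens_lift (tens_proj_bal n).

Lemma tens_deg_tens i j p b : gm_deg i p -> gr_deg j b ->
  tens_deg (i + j) (tens p b).
Proof.
move=> Hp Hb; exists [:: (p, b)]; split; first by rewrite big_seq1.
by move=> u; rewrite inE => /eqP ->; exists i, j.
Qed.

Lemma tens_deg0 n : tens_deg n 0.
Proof. by exists [::]; split=> //; rewrite big_nil. Qed.

Lemma tens_degD n x y : tens_deg n x -> tens_deg n y -> tens_deg n (x + y).
Proof.
move=> [s [-> Hs]] [t [-> Ht]]; exists (s ++ t); split; first by rewrite big_cat.
by move=> u; rewrite mem_cat => /orP[/Hs|/Ht].
Qed.

Lemma tens_degN n x : tens_deg n x -> tens_deg n (- x).
Proof.
move=> [s [-> Hs]]; exists [seq (- u.1, u.2) | u <- s]; split.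
  rewrite big_map -sumrN; apply: eq_bigr => u _ /=.
  by rewrite (balNl _ _ tens_balanced).
move=> v /mapP[u /Hs[i [j [e Hi Hj]]] ->]; exists i, j; split=> //=.
exact: gradingN.
Qed.

Fact tens_grading : is_grading tens_deg.
Proof.
apply: (@grading_of_proj _ _ tens_proj).
- exact: tens_deg0.
- by move=> n x y Hx Hy; apply: tens_degD => //; apply: tens_degN.
- by move=> n x y; apply: tens_liftD; apply: tens_proj_balanced.
- move=> n x m [s [-> Hs]].
  rewrite /tens_proj (big_morph _ (tens_liftD (tens_proj_balanced m))
    (tens_lift0 (tens_proj_balanced m))).
  case: eqP => mn.
    rewrite [LHS]big_seq [RHS]big_seq; apply: eq_bigr => u /Hs[i [j [e Hi Hj]]].
    rewrite tens_liftE; last exact: tens_proj_balanced.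
    by rewrite (tens_projEE _ Hi Hj) e mn eqxx.
  rewrite big_seq big1 // => u /Hs[i [j [e Hi Hj]]].
  rewrite tens_liftE; last exact: tens_proj_balanced.
  by rewrite (tens_projEE _ Hi Hj) e; case: eqP.
- move=> Q Q0 QD QG; apply: tens_ind => // p b.
  have [Dl Dr bA] := tens_balanced.
  move: p; apply: (grading_ind HP) => [|p q Hp Hq|i p Hp].
  + by rewrite (bal0l _ tens_balanced).
  + by rewrite Dl; apply: QD.
  move: b; apply: (grading_ind HB) => [|b b' Hb Hb'|k b Hb].
  + by rewrite (bal0r _ tens_balanced).
  + by rewrite Dr; apply: QD.
  exact: QG (tens_deg_tens Hp Hb).
Qed.

Lemma tens_rscaleE (c : B) p b : (c : B^c) *: tens p b = tens p (b * c).
Proof. exact: tens_scaleE. Qed.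

Fact tens_degZ m n (x : tensor) (c : B) :
  tens_deg m x -> gr_deg n c -> tens_deg (m + n) ((c : B^c) *: x).
Proof.
move=> [s [-> Hs]] Hc; rewrite scaler_sumr.
rewrite big_seq; elim/big_ind: _ => [|x' y|u /Hs[i [j [<- Hi Hj]]]].
- exact: tens_deg0.
- exact: tens_degD.
rewrite tens_rscaleE -addrA; apply: tens_deg_tens => //; exact: gr_degM.
Qed.

Definition gextend : gModule B := @GModule B tensor tens_deg tens_grading tens_degZ.

Definition gext_in (p : P) : gextend := tens p 1.

Definition semilinear_hom (N : gModule B) (g : P -> N) : Prop :=
  [/\ forall p q, g (p + q) = g p + g q,
      forall p (a : A), g ((a : A^c) *: p) = (f a : B^c) *: g p
    & forall n p, gm_deg n p -> gm_deg n (g p)].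

Lemma gext_in_semilinear : semilinear_hom gext_in.
Proof.
split=> [p q|p a|n p Hp].
- exact: (balDl tens_balanced).
- rewrite [RHS]tens_rscaleE mul1r /gext_in (balA tens_balanced).
  by rewrite mulr1.
- by rewrite -[n]addr0; apply: tens_deg_tens => //; apply: gr_deg1.
Qed.

Section UniversalProperty.
Variables (N : gModule B) (g : P -> N).
Hypothesis Hg : semilinear_hom g.

Let beta (p : P) (b : B) : N := (b : B^c) *: g p.

Let Hbeta : balanced beta.
Proof.
have [gD gZ _] := Hg; split=> [p q b|p b c|p a b]; rewrite /beta.
- by rewrite gD scalerDr.
- by rewrite [LHS]scalerDl.
- by rewrite gZ rscalerA.
Qed.

Definition gext_lift : gModHom gextend N.
Proof.
apply: (@mkhom B gextend N (tens_lift beta)).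
- exact: (tens_liftD Hbeta).
- move=> c x; elim/tens_ind: x => [|x y Hx Hy|p b].
  + by rewrite scaler0 (tens_lift0 Hbeta) scaler0.
  + by rewrite scalerDr !(tens_liftD Hbeta) Hx Hy scalerDr.
  + by rewrite tens_rscaleE !(tens_liftE Hbeta) /beta rscalerA.
- have [_ _ gdeg] := Hg.
  move=> n x [s [-> Hs]].
  rewrite (big_morph _ (tens_liftD Hbeta) (tens_lift0 Hbeta)) big_seq.
  apply: (grading_bigsum (gm_grading N)) => u /Hs[i [j [<- Hi Hj]]].
  by rewrite (tens_liftE Hbeta); apply: gm_degZ => //; apply: gdeg.
Defined.

Lemma gext_liftE p : gext_lift (gext_in p) = g p.
Proof.
rewrite /gext_lift mkhomE /gext_in (tens_liftE Hbeta) /beta.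
by rewrite [LHS]scale1r.
Qed.

End UniversalProperty.

Lemma gext_hom_ext (N : gModule B) (g h : gModHom gextend N) :
  (forall p, g (gext_in p) = h (gext_in p)) -> g =1 h.
Proof.
move=> gh x; elim/tens_ind: x => [|x y Hx Hy|p b].
- by rewrite !raddf0.
- by rewrite !raddfD /= Hx Hy.
have -> : tens p b = (b : B^c) *: gext_in p :> gextend.
  by rewrite [RHS]tens_rscaleE mul1r.
by rewrite !linearZ /= gh.
Qed.

Lemma gextend_fg : finitely_generated P -> finitely_generated gextend.
Proof.
move=> [n [g gP]]; exists n, (fun i => gext_in (g i)).
move=> x; elim/tens_ind: x => [|x y [a ->] [b ->]|p b].
- exists (fun=> 0); rewrite big1 // => i _; exact: scale0r.
- exists (fun i => a i + b i); rewrite -big_split; apply: eq_bigr => i _.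
  by rewrite [RHS]scalerDl.
- have [a ->] := gP p; exists (fun i => f (a i) * b).
  rewrite (big_morph (tens^~ b) (fun p q => balDl tens_balanced p q b)
    (bal0l b tens_balanced)).
  apply: eq_bigr => i _.
  by rewrite (balA tens_balanced) [RHS]tens_rscaleE mul1r.
Qed.

Lemma gextend_proj : gprojective P -> gprojective gextend.
Proof.
move=> pP M N g h gs.
have @g' : gModHom (grestr f M) (grestr f N).
  apply: (@mkhom A (grestr f M) (grestr f N) (g : M -> N)).
  - exact: (raddfD g).
  - by move=> a x; exact: (linearZZ g (f a : B^c) x).
  - by move=> n x; apply: (gmh_deg g).
have [iD iZ ideg] := gext_in_semilinear.
have @h' : gModHom P (grestr f N).
  apply: (@mkhom A P (grestr f N) (fun p => h (gext_in p) : N)).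
  - by move=> x y; rewrite iD; apply: (raddfD h).
  - by move=> a x; rewrite iZ; exact: (linearZZ h (f a : B^c)).
  - by move=> n x Hx; apply: (gmh_deg h); apply: ideg.
have [k kP] := pP _ _ g' h' gs.
have Hk : semilinear_hom (N := M) (fun p => k p : M).
  split.
  - by move=> p q; apply: (raddfD k).
  - by move=> p a; exact: (linearZZ k (a : A^c) p).
  - by move=> n p Hp; apply: (gmh_deg k Hp).
exists (gext_lift Hk).
apply: (gext_hom_ext (g := gmh_comp g (gext_lift Hk)) (h := h)) => p.
by rewrite mkhomE gext_liftE; apply: kP.
Qed.

End Tensor.
Arguments gextend_proj {A B} f {P} _ : rename.

Section ExtendFgp.
Variables (A B : gRing) (f : gRingHom A B).

Definition fgp_extend (P : fgpModule A) : fgpModule B :=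
  FgpModule (gextend_fg f (fgp_fg P)) (gextend_proj f (fgp_proj P)).

Lemma gext_semilinear_comp (M N : gModule A) (P : gModule B)
  (g : gModHom M N) (h : N -> P) :
  semilinear_hom f h -> semilinear_hom f (fun x => h (g x)).
Proof.
move=> [hD hZ hdeg]; split=> [p q|p a|n p Hp].
- by rewrite raddfD hD.
- by rewrite linearZ hZ.
- by apply/hdeg/gmh_deg.
Qed.

Lemma gextend_iso (P Q : gModule A) :
  gmod_iso P Q -> gmod_iso (gextend f P) (gextend f Q).
Proof.
move=> [g [h [gh hg]]].
pose G := gext_lift (gext_semilinear_comp g (gext_in_semilinear f Q)).
pose H := gext_lift (gext_semilinear_comp h (gext_in_semilinear f P)).
exists G, H; split.
  apply: (gext_hom_ext (g := gmh_comp H G) (h := gmh_id _)) => p.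
  by rewrite mkhomE !gext_liftE gh.
apply: (gext_hom_ext (g := gmh_comp G H) (h := gmh_id _)) => p.
by rewrite mkhomE !gext_liftE hg.
Qed.

Lemma gextend0 : gmod_iso (gextend f (gzero A)) (gzero B).
Proof.
have Hz : semilinear_hom f (N := gzero B) (fun _ : gzero A => 0).
  split=> // *; [by rewrite addr0|by rewrite scaler0].
have Hz' : forall n (x : gzero B), gm_deg n x -> gm_deg n (0 : gextend f (gzero A)).
  by move=> n x _; apply: grading0 (gm_grading (gextend f (gzero A))) n.
exists (gext_lift Hz), (@mkhom B (gzero B) _ (fun=> 0)
  (fun _ _ => esym (addr0 _)) (fun a _ => esym (scaler0 _ _)) Hz').
split=> x; last exact: gzero_eq.
rewrite mkhomE; apply: esym; elim/tens_ind: x => [//|x y -> ->|p b].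
  by rewrite addr0.
by rewrite (gzero_eq p 0) (bal0l _ (tens_balanced f (gzero A))).
Qed.

Lemma gextendD (P Q : gModule A) :
  gmod_iso (gextend f (gsum P Q)) (gsum (gextend f P) (gextend f Q)).
Proof.
have [iPD iPZ iPdeg] := gext_in_semilinear f P.
have [iQD iQZ iQdeg] := gext_in_semilinear f Q.
have Hs : semilinear_hom f (N := gsum (gextend f P) (gextend f Q))
    (fun x : gsum P Q => (gext_in f x.1, gext_in f x.2)).
  split=> [p q|p a|n p [? ?]].
  - by congr pair; rewrite /= ?iPD ?iQD.
  - by congr pair; rewrite /= ?iPZ ?iQZ.
  - by split; [apply: iPdeg|apply: iQdeg].
pose G := gext_lift Hs.
pose L1 := gext_lift
  (gext_semilinear_comp (gsum_inl P Q) (gext_in_semilinear f (gsum P Q))).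
pose L2 := gext_lift
  (gext_semilinear_comp (gsum_inr P Q) (gext_in_semilinear f (gsum P Q))).
have L1E p : L1 (gext_in f p) = gext_in f ((p, 0) : gsum P Q).
  exact: gext_liftE.
have L2E p : L2 (gext_in f p) = gext_in f ((0, p) : gsum P Q).
  exact: gext_liftE.
have GE x y : G (gext_in f ((x, y) : gsum P Q)) = (gext_in f x, gext_in f y).
  exact: gext_liftE.
have [iD _ _] := gext_in_semilinear f (gsum P Q).
exists G, (gsum_pair L1 L2); split.
  apply: (gext_hom_ext (g := gmh_comp (gsum_pair L1 L2) G) (h := gmh_id _)).
  move=> [x y].
  change (gsum_pair L1 L2 (G (gext_in f ((x, y) : gsum P Q)))
    = gext_in f ((x, y) : gsum P Q)).
  rewrite GE.
  change (L1 (gext_in f x) + L2 (gext_in f y) = gext_in f ((x, y) : gsum P Q)).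
  rewrite L1E L2E -iD; congr gext_in.
  by congr pair; rewrite /= ?addr0 ?add0r.
have H0P : gext_in f (0 : P) = 0.
  by apply: (addrI (gext_in f (0 : P))); rewrite -iPD !addr0.
have H0Q : gext_in f (0 : Q) = 0.
  by apply: (addrI (gext_in f (0 : Q))); rewrite -iQD !addr0.
case=> x y; change (G (L1 x + L2 y) = (x, y)).
transitivity (G (L1 x) + G (L2 y)); first exact: raddfD.
have -> : G (L1 x) = (x, 0).
  apply: (gext_hom_ext (g := gmh_comp G L1) (h := gsum_inl _ _)) => p.
  by change (G (L1 (gext_in f p)) = (gext_in f p, 0)); rewrite L1E GE H0Q.
have -> : G (L2 y) = (0, y).
  apply: (gext_hom_ext (g := gmh_comp G L2) (h := gsum_inr _ _)) => p.
  by change (G (L2 (gext_in f p)) = (0, gext_in f p)); rewrite L2E GE H0P.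
by congr pair; rewrite /= ?addr0 ?add0r.
Qed.

Definition VgrMap_fun (x : Vgr A) : Vgr B := Vclass (fgp_extend (qrepr x)).

Lemma VgrMapE P : VgrMap_fun (Vclass P) = Vclass (fgp_extend P).
Proof. by apply/VclassE; apply: gextend_iso; apply: qrepr_Vclass. Qed.

Fact VgrMap0 : VgrMap_fun (abm0 (Vgr A)) = abm0 (Vgr B).
Proof. by rewrite VgrMapE; apply/VclassE; apply: gextend0. Qed.

Fact VgrMapD (x y : Vgr A) :
  VgrMap_fun (abmD x y) = abmD (VgrMap_fun x) (VgrMap_fun y).
Proof.
have [[P ->] [Q ->]] := (VclassP x, VclassP y).
by rewrite /= VgrDE !VgrMapE VgrDE; apply/VclassE; apply: gextendD.
Qed.

Definition VgrMap : abMonoidHom (Vgr A) (Vgr B) := AbMonoidHom VgrMap0 VgrMapD.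

(* [P] - [Q] is mapped to [P (x)_A B] - [Q (x)_A B] *)
Definition K0grMap : abGroupHom (K0gr A) (K0gr B) := grothMap VgrMap.

End ExtendFgp.

Section ExtendComp.
Variables (A B C : gRing) (f : gRingHom A B) (g : gRingHom B C).
Variable h : gRingHom A C.
Hypothesis hE : forall a, h a = g (f a).

Lemma gextend_comp (P : gModule A) :
  gmod_iso (gextend h P) (gextend g (gextend f P)).
Proof.
have [iD iZ ideg] := gext_in_semilinear f P.
have [jD jZ jdeg] := gext_in_semilinear g (gextend f P).
have [kD kZ kdeg] := gext_in_semilinear h P.
have H1 : semilinear_hom h (fun p : P => gext_in g (gext_in f p)).
  split=> [p q|p a|n p Hp].
  - by rewrite iD jD.
  - by rewrite iZ jZ hE.
  - by apply/jdeg/ideg.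
have H2 : semilinear_hom f (N := grestr g (gextend h P)) (gext_in h (P := P)).
  split=> [p q|p a|n p Hp].
  - exact: kD.
  - by rewrite kZ hE.
  - exact: kdeg.
pose k := gext_lift H2.
have H3 : semilinear_hom g (N := gextend h P) (fun x => k x : gextend h P).
  split=> [p q|p a|n p Hp].
  - exact: (raddfD k).
  - exact: (linearZZ k (a : B^c) p).
  - exact: (gmh_deg k Hp).
pose u := gext_lift H1; pose w := gext_lift H3.
have uE p : u (gext_in h p) = gext_in g (gext_in f p) by exact: gext_liftE.
have wE x : w (gext_in g x) = k x by exact: gext_liftE.
have kE p : k (gext_in f p) = gext_in h p by exact: gext_liftE.
exists u, w; split.
  apply: (gext_hom_ext (g := gmh_comp w u) (h := gmh_id _)) => p.
  change (w (u (gext_in h p)) = gext_in h p).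
  by rewrite uE wE kE.
apply: (gext_hom_ext (g := gmh_comp u w) (h := gmh_id _)) => x.
change (u (w (gext_in g x)) = gext_in g x).
rewrite wE.
have Hu : semilinear_hom (N := grestr g (gextend g (gextend f P))) f
   (fun p : P => u (gext_in h p)).
  split=> [p q|p a|n p Hp].
  - by rewrite kD; apply: (raddfD u).
  - by rewrite kZ hE; exact: (linearZZ u).
  - exact: (gmh_deg u (kdeg _ _ Hp)).
have @r : gModHom (grestr g (gextend h P)) (grestr g (gextend g (gextend f P))).
  apply: (@mkhom B (grestr g (gextend h P)) (grestr g (gextend g (gextend f P)))
    (u : gextend h P -> _)).
  - exact: (raddfD u).
  - by move=> a y; exact: (linearZZ u).
  - by move=> n y; apply: (gmh_deg u).
have @j : gModHom (gextend f P) (grestr g (gextend g (gextend f P))).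
  apply: (@mkhom B (gextend f P) (grestr g (gextend g (gextend f P)))
    (gext_in g (P := gextend f P))).
  - exact: jD.
  - by move=> a y; apply: jZ.
  - exact: jdeg.
apply: (gext_hom_ext (g := gmh_comp r k) (h := j)) => p.
change (u (k (gext_in f p)) = gext_in g (gext_in f p)).
by rewrite kE uE.
Qed.

Lemma VgrMap_comp (x : Vgr A) : VgrMap h x = VgrMap g (VgrMap f x).
Proof.
have [P ->] := VclassP x.
rewrite /VgrMap /= VgrMapE [in RHS]VgrMapE [in RHS]VgrMapE.
by apply/VclassE; apply: (gextend_comp P).
Qed.

Lemma K0grMap_comp (x : K0gr A) : K0grMap h x = K0grMap g (K0grMap f x).
Proof.
have [a [b ->]] := grothP x.
rewrite /K0grMap /= grothMapE [in RHS]grothMapE [in RHS]grothMapE.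
by rewrite !VgrMap_comp.
Qed.

End ExtendComp.

Record nuAlgebra (K : fieldType) := NuAlgebra {
  nua_mod :> lmodType K;
  nuM : nua_mod -> nua_mod -> nua_mod;
  nuMA : associative nuM;
  nuMDl : left_distributive nuM +%R;
  nuMDr : right_distributive nuM +%R;
  nuMZl : forall (c : K) x y, nuM (c *: x) y = c *: nuM x y;
  nuMZr : forall (c : K) x y, nuM x (c *: y) = c *: nuM x y }.

Record gAlgebra (K : fieldType) := GAlgebra {
  ga_alg :> nuAlgebra K;
  ga_deg : int -> set ga_alg;
  ga_grading : is_grading ga_deg;
  ga_degZ : forall n (c : K) x, ga_deg n x -> ga_deg n (c *: x);
  ga_degM : forall m n x y,
    ga_deg m x -> ga_deg n y -> ga_deg (m + n) (nuM x y) }.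
Arguments ga_deg {K g}.

Record gAlgHom (K : fieldType) (A B : gAlgebra K) := GAlgHom {
  gah_fun :> {linear A -> B};
  gahM : forall x y, gah_fun (nuM x y) = nuM (gah_fun x) (gah_fun y);
  gah_deg : forall n x, ga_deg n x -> ga_deg n (gah_fun x) }.

Section NuTheory.
Variables (K : fieldType) (A : nuAlgebra K).
Implicit Types x y : A.

Lemma nuM0l x : nuM 0 x = 0.
Proof. by apply: (addrI (nuM 0 x)); rewrite -nuMDl !addr0. Qed.
Lemma nuM0r x : nuM x 0 = 0.
Proof. by apply: (addrI (nuM x 0)); rewrite -nuMDr !addr0. Qed.
Lemma nuMNl x y : nuM (- x) y = - nuM x y.
Proof. by rewrite -!scaleN1r nuMZl. Qed.
Lemma nuMNr x y : nuM x (- y) = - nuM x y.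
Proof. by rewrite -!scaleN1r nuMZr. Qed.

Lemma nuMzl x y (m : int) : nuM (x *~ m) y = nuM x y *~ m.
Proof. by rewrite -!scaler_int nuMZl. Qed.
Lemma nuMzr x y (m : int) : nuM x (y *~ m) = nuM x y *~ m.
Proof. by rewrite -!scaler_int nuMZr. Qed.

Definition unitization : Type := (A * int)%type.
HB.instance Definition _ := GRing.Zmodule.on unitization.

Definition utz_one : unitization := (0, 1).
Definition utz_mul (u v : unitization) : unitization :=
  (nuM u.1 v.1 + v.1 *~ u.2 + u.1 *~ v.2, u.2 * v.2).

Fact utz_mulA : associative utz_mul.
Proof.
move=> [x m] [y n] [z p]; congr pair => /=; last by rewrite mulrA.
rewrite !nuMDl !nuMDr !nuMA !nuMzl !nuMzr !mulrzDl !mulrzA.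
rewrite [z *~ n *~ m]mulrzAC [y *~ p *~ m]mulrzAC.
by rewrite [LHS](AC (3*3*1) ((1*4*2)*5*(3*6*7))).
Qed.
Fact utz_mul1 : left_id utz_one utz_mul.
Proof.
by move=> [x m]; congr pair; rewrite /= ?mul1r // nuM0l mul0rz add0r addr0.
Qed.
Fact utz_mulr1 : right_id utz_one utz_mul.
Proof.
by move=> [x m]; congr pair; rewrite /= ?mulr1 // nuM0r mul0rz !add0r.
Qed.
Fact utz_mulDl : left_distributive utz_mul +%R.
Proof.
move=> [x m] [y n] [z p]; congr pair => /=; last by rewrite mulrDl.
rewrite nuMDl mulrzDl mulrzDr.
by rewrite [LHS](AC (2*2*2) ((1*3*5)*(2*4*6))).
Qed.
Fact utz_mulDr : right_distributive utz_mul +%R.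
Proof.
move=> [x m] [y n] [z p]; congr pair => /=; last by rewrite mulrDr.
rewrite nuMDr mulrzDl mulrzDr.
by rewrite [LHS](AC (2*2*2) ((1*3*5)*(2*4*6))).
Qed.

HB.instance Definition _ := GRing.Zmodule_isPzRing.Build unitization
  utz_mulA utz_mul1 utz_mulr1 utz_mulDl utz_mulDr.

End NuTheory.

Section IntGRing.

Definition int_deg (n : int) : set int := [set m | n = 0 \/ m = 0]%classic.

Fact int_grading : is_grading int_deg.
Proof.
apply: (@grading_of_proj _ _ (fun n m => if n == 0 then m else 0)).
- by move=> n; right.
- move=> n x y [->|->] Hy; first by left.
  by case: Hy => ->; [left|right].
- by move=> n x y; case: eqP; rewrite ?addr0.
- move=> n x m [->//|->]; by case: eqP; case: eqP.
- by move=> Q Q0 QD QG x; apply: (QG 0); left.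
Qed.

Fact int_deg1 : int_deg 0 1. Proof. by left. Qed.
Fact int_degM m n a b : int_deg m a -> int_deg n b -> int_deg (m + n) (a * b).
Proof.
move=> [->|->] [->|->]; rewrite ?mulr0 ?mul0r; by [left|right].
Qed.

Definition int_gRing : gRing := @MkGRing int int_deg int_grading int_deg1 int_degM.

End IntGRing.

Section UnitizationGraded.
Variables (K : fieldType) (A : gAlgebra K).

Definition utz_deg (n : int) : set (unitization A) :=
  [set u | ga_deg n u.1 /\ int_deg n u.2]%classic.

Fact utz_grading : is_grading utz_deg.
Proof.
have HA := ga_grading A.
apply: (@grading_of_proj (unitization A) _ (fun n (u : unitization A) =>
  (gcomp HA n u.1, gcomp int_grading n u.2) : unitization A)).
- by move=> n; split; [apply: grading0 HA n|apply: grading0 int_grading n].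
- by move=> n x y [? ?] [? ?]; split;
    [apply: (gradingB HA)|apply: (gradingB int_grading)].
- by move=> n x y /=; rewrite !gcompD.
- move=> n [x y] m [/= Hx Hy].
  rewrite (gcomp_id HA m Hx) (gcomp_id int_grading m Hy).
  by case: eqP.
- move=> Q Q0 QD QG [x y].
  have -> : (x, y) = (x, 0) + (0, y) :> unitization A.
    by congr pair; rewrite /= ?addr0 ?add0r.
  apply: (QD); last by apply: (QG 0); split; [apply: grading0|left].
  apply: (grading_ind HA (Q := fun x => Q (x, 0)))
    => [|{}x x' Qx Qx'|n {}x Hx]; first exact: Q0.
    have -> : (x + x', 0) = (x, 0) + (x', 0) :> unitization A.
      by congr pair; rewrite /= ?addr0.
    exact: QD.
  by apply: (QG n); split=> //; right.
Qed.

Fact utz_deg1 : utz_deg 0 1.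
Proof. by split; [apply: grading0 (ga_grading A) 0|left]. Qed.

Fact utz_degM m n u v : utz_deg m u -> utz_deg n v -> utz_deg (m + n) (u * v).
Proof.
have HA := ga_grading A.
have Hz k x p : ga_deg k x -> ga_deg k (x *~ p : A).
  by move=> Hx; rewrite -scaler_int; apply: ga_degZ.
case: u v => [x p] [y q] [/= Hx Hp] [/= Hy Hq]; split=> /=; last exact: int_degM.
apply: (gradingD HA); first apply: (gradingD HA).
- exact: ga_degM.
- by case: Hp => ->; [rewrite add0r; apply: Hz|rewrite mulr0z; apply: grading0].
- by case: Hq => ->; [rewrite addr0; apply: Hz|rewrite mulr0z; apply: grading0].
Qed.

Definition gunitization : gRing :=
  @MkGRing (unitization A) utz_deg utz_grading utz_deg1 utz_degM.

Definition utz_aug_fun (u : gunitization) : int_gRing := u.2.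

Fact utz_aug_additive : zmod_morphism utz_aug_fun. Proof. by []. Qed.
Fact utz_aug_multiplicative : monoid_morphism utz_aug_fun. Proof. by []. Qed.
HB.instance Definition _ := GRing.isZmodMorphism.Build gunitization int_gRing
  utz_aug_fun utz_aug_additive.
HB.instance Definition _ := GRing.isMonoidMorphism.Build gunitization int_gRing
  utz_aug_fun utz_aug_multiplicative.

Fact utz_aug_deg n (u : gunitization) :
  gr_deg n u -> gr_deg n (utz_aug_fun u).
Proof. by case. Qed.

Definition utz_aug : gRingHom gunitization int_gRing := GRingHom utz_aug_deg.

(* K_0^gr of a possibly nonunital A: the kernel of K_0^gr(A~) -> K_0^gr(Z).
   It is used for unital A as well, where it is naturally isomorphic to the
   Grothendieck group of A-modules, because algebra homomorphisms need not
   preserve units and functoriality goes through A~. *)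
Definition K0gr_nu : abGroup := kerGroup (K0grMap utz_aug).

End UnitizationGraded.

Section UnitizationMap.
Variables (K : fieldType) (A B : gAlgebra K) (f : gAlgHom A B).

Definition utz_map_fun (u : gunitization A) : gunitization B := (f u.1, u.2).

Fact utz_map_additive : zmod_morphism utz_map_fun.
Proof. by move=> u v; congr pair; rewrite /= raddfB. Qed.
Fact utz_map_multiplicative : monoid_morphism utz_map_fun.
Proof.
split; first by congr pair; rewrite /= raddf0.
by move=> u v; congr pair; rewrite /= !raddfD /= gahM !raddfMz.
Qed.
HB.instance Definition _ := GRing.isZmodMorphism.Build (gunitization A)
  (gunitization B) utz_map_fun utz_map_additive.
HB.instance Definition _ := GRing.isMonoidMorphism.Build (gunitization A)
  (gunitization B) utz_map_fun utz_map_multiplicative.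

Fact utz_map_deg n u : gr_deg n u -> gr_deg n (utz_map_fun u).
Proof. by case=> ? ?; split=> //; apply: gah_deg. Qed.

Definition utz_map : gRingHom (gunitization A) (gunitization B) :=
  GRingHom utz_map_deg.

Fact K0gr_nu_aug (x : K0gr (gunitization A)) :
  K0grMap (utz_aug B) (K0grMap utz_map x) = K0grMap (utz_aug A) x.
Proof. by rewrite -(K0grMap_comp (h := utz_aug A)). Qed.

Definition K0gr_nuMap : abGroupHom (K0gr_nu A) (K0gr_nu B) :=
  kerMap (h := K0grMap (utz_aug A)) (h' := K0grMap (utz_aug B))
    (u := K0grMap utz_map) (v := abGroupHom_id _)
    K0gr_nu_aug.

End UnitizationMap.

Record finGraph := FinGraph {
  vertex : finType;
  edge : finType;
  src : edge -> vertex;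
  rng : edge -> vertex }.
Arguments src {f} : rename.
Arguments rng {f} : rename.

Section Leavitt.
Variables (K : fieldType) (E : finGraph).

Inductive lpa_term : Type :=
  | LVertex of vertex E
  | LEdge of edge E
  | LGhost of edge E
  | LZero
  | LAdd of lpa_term & lpa_term
  | LOpp of lpa_term
  | LScale of K & lpa_term
  | LMul of lpa_term & lpa_term.

(* the least congruence on terms that satisfies the axioms of associative
   (nonunital) K-algebras and the defining relations *)
Inductive lpa_rel : lpa_term -> lpa_term -> Prop :=
  | LR_refl a : lpa_rel a a
  | LR_sym a b : lpa_rel a b -> lpa_rel b a
  | LR_trans a b c : lpa_rel a b -> lpa_rel b c -> lpa_rel a c
  | LR_add a a' b b' :
      lpa_rel a a' -> lpa_rel b b' -> lpa_rel (LAdd a b) (LAdd a' b')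
  | LR_opp a a' : lpa_rel a a' -> lpa_rel (LOpp a) (LOpp a')
  | LR_scale k a a' : lpa_rel a a' -> lpa_rel (LScale k a) (LScale k a')
  | LR_mul a a' b b' :
      lpa_rel a a' -> lpa_rel b b' -> lpa_rel (LMul a b) (LMul a' b')
  | LR_addA a b c : lpa_rel (LAdd a (LAdd b c)) (LAdd (LAdd a b) c)
  | LR_addC a b : lpa_rel (LAdd a b) (LAdd b a)
  | LR_add0 a : lpa_rel (LAdd LZero a) a
  | LR_addN a : lpa_rel (LAdd (LOpp a) a) LZero
  | LR_scaleA k l a : lpa_rel (LScale k (LScale l a)) (LScale (k * l) a)
  | LR_scale1 a : lpa_rel (LScale 1 a) a
  | LR_scaleDr k a b :
      lpa_rel (LScale k (LAdd a b)) (LAdd (LScale k a) (LScale k b))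
  | LR_scaleDl k l a :
      lpa_rel (LScale (k + l) a) (LAdd (LScale k a) (LScale l a))
  | LR_mulA a b c : lpa_rel (LMul a (LMul b c)) (LMul (LMul a b) c)
  | LR_mulDl a b c : lpa_rel (LMul (LAdd a b) c) (LAdd (LMul a c) (LMul b c))
  | LR_mulDr a b c : lpa_rel (LMul a (LAdd b c)) (LAdd (LMul a b) (LMul a c))
  | LR_mulZl k a b : lpa_rel (LMul (LScale k a) b) (LScale k (LMul a b))
  | LR_mulZr k a b : lpa_rel (LMul a (LScale k b)) (LScale k (LMul a b))
  | LR_vertex v w :
      lpa_rel (LMul (LVertex v) (LVertex w)) (if v == w then LVertex v else LZero)
  | LR_src e : lpa_rel (LMul (LVertex (src e)) (LEdge e)) (LEdge e)
  | LR_rng e : lpa_rel (LMul (LEdge e) (LVertex (rng e))) (LEdge e)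
  | LR_ghost_rng e : lpa_rel (LMul (LVertex (rng e)) (LGhost e)) (LGhost e)
  | LR_ghost_src e : lpa_rel (LMul (LGhost e) (LVertex (src e))) (LGhost e)
  | LR_CK1 e f :
      lpa_rel (LMul (LGhost e) (LEdge f)) (if e == f then LVertex (rng e) else LZero)
  | LR_CK2 v : (0 < #|[set e | src e == v]|)%N ->
      lpa_rel (LVertex v)
        (foldr LAdd LZero
           [seq LMul (LEdge e) (LGhost e) | e <- enum [set e | src e == v]]).

HB.instance Definition _ := gen_eqMixin lpa_term.
HB.instance Definition _ := gen_choiceMixin lpa_term.

Definition lpa_relb (a b : lpa_term) : bool := `[< lpa_rel a b >].

Fact lpa_relb_refl : reflexive lpa_relb.
Proof. by move=> a; apply/asboolP; apply: LR_refl. Qed.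
Fact lpa_relb_sym : symmetric lpa_relb.
Proof. by move=> a b; apply/asboolP/asboolP; apply: LR_sym. Qed.
Fact lpa_relb_trans : transitive lpa_relb.
Proof.
by move=> a b c /asboolP ba /asboolP ac; apply/asboolP; apply: LR_trans ba ac.
Qed.

Canonical lpa_equiv :=
  EquivRel lpa_relb lpa_relb_refl lpa_relb_sym lpa_relb_trans.

Definition lpa_type := {eq_quot lpa_equiv}.
HB.instance Definition _ := Choice.on lpa_type.
HB.instance Definition _ := EqQuotient.on lpa_type.

Definition lcl (a : lpa_term) : lpa_type := \pi_lpa_type a.

Lemma lclE a b : lcl a = lcl b <-> lpa_rel a b.
Proof.
split=> [/eqP|H]; first by rewrite eqmodE => /asboolP.
by apply/eqP; rewrite eqmodE; apply/asboolP.
Qed.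

Lemma lclP (x : lpa_type) : exists a, x = lcl a.
Proof. by exists (repr x); rewrite /lcl reprK. Qed.

Lemma lcl_repr a : lpa_rel (repr (lcl a)) a.
Proof. by apply/lclE; rewrite /lcl reprK. Qed.

Definition lpaD (x y : lpa_type) : lpa_type := lcl (LAdd (repr x) (repr y)).
Definition lpaN (x : lpa_type) : lpa_type := lcl (LOpp (repr x)).
Definition lpaZ (k : K) (x : lpa_type) : lpa_type := lcl (LScale k (repr x)).
Definition lpaM (x y : lpa_type) : lpa_type := lcl (LMul (repr x) (repr y)).

Lemma lpaDE a b : lpaD (lcl a) (lcl b) = lcl (LAdd a b).
Proof. by apply/lclE; apply: LR_add; apply: lcl_repr. Qed.
Lemma lpaNE a : lpaN (lcl a) = lcl (LOpp a).
Proof. by apply/lclE; apply: LR_opp; apply: lcl_repr. Qed.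
Lemma lpaZE k a : lpaZ k (lcl a) = lcl (LScale k a).
Proof. by apply/lclE; apply: LR_scale; apply: lcl_repr. Qed.
Lemma lpaME a b : lpaM (lcl a) (lcl b) = lcl (LMul a b).
Proof. by apply/lclE; apply: LR_mul; apply: lcl_repr. Qed.

Let lpaE := (lpaDE, lpaNE, lpaZE, lpaME).

Fact lpaDA : associative lpaD.
Proof.
move=> x y z; have [[a ->] [[b ->] [c ->]]] := (lclP x, (lclP y, lclP z)).
by rewrite !lpaE; apply/lclE; apply: LR_addA.
Qed.
Fact lpaDC : commutative lpaD.
Proof.
move=> x y; have [[a ->] [b ->]] := (lclP x, lclP y).
by rewrite !lpaE; apply/lclE; apply: LR_addC.
Qed.
Fact lpa0D : left_id (lcl LZero) lpaD.
Proof.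
by move=> x; have [a ->] := lclP x; rewrite !lpaE; apply/lclE; apply: LR_add0.
Qed.
Fact lpaND : left_inverse (lcl LZero) lpaN lpaD.
Proof.
by move=> x; have [a ->] := lclP x; rewrite !lpaE; apply/lclE; apply: LR_addN.
Qed.

HB.instance Definition _ := GRing.isZmodule.Build lpa_type lpaDA lpaDC lpa0D lpaND.

Fact lpaZA k l x : lpaZ k (lpaZ l x) = lpaZ (k * l) x.
Proof.
by have [a ->] := lclP x; rewrite !lpaE; apply/lclE; apply: LR_scaleA.
Qed.
Fact lpaZ1 : left_id 1 lpaZ.
Proof.
by move=> x; have [a ->] := lclP x; rewrite !lpaE; apply/lclE; apply: LR_scale1.
Qed.
Fact lpaZDr : right_distributive lpaZ lpaD.
Proof.
move=> k x y; have [[a ->] [b ->]] := (lclP x, lclP y).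
by rewrite !lpaE; apply/lclE; apply: LR_scaleDr.
Qed.
Fact lpaZDl x : {morph lpaZ^~ x : k l / k + l >-> lpaD k l}.
Proof.
move=> k l; have [a ->] := lclP x.
by rewrite !lpaE; apply/lclE; apply: LR_scaleDl.
Qed.

HB.instance Definition _ :=
  GRing.Zmodule_isLmodule.Build K lpa_type lpaZA lpaZ1 lpaZDr lpaZDl.

Fact lpaMA : associative lpaM.
Proof.
move=> x y z; have [[a ->] [[b ->] [c ->]]] := (lclP x, (lclP y, lclP z)).
by rewrite !lpaE; apply/lclE; apply: LR_mulA.
Qed.
Fact lpaMDl : left_distributive lpaM +%R.
Proof.
move=> x y z; have [[a ->] [[b ->] [c ->]]] := (lclP x, (lclP y, lclP z)).
by rewrite [lcl a + lcl b]lpaDE !lpaME [RHS]lpaDE; apply/lclE; apply: LR_mulDl.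
Qed.
Fact lpaMDr : right_distributive lpaM +%R.
Proof.
move=> x y z; have [[a ->] [[b ->] [c ->]]] := (lclP x, (lclP y, lclP z)).
by rewrite [lcl b + lcl c]lpaDE !lpaME [RHS]lpaDE; apply/lclE; apply: LR_mulDr.
Qed.
Fact lpaMZl (k : K) (x y : lpa_type) : lpaM (k *: x) y = k *: lpaM x y.
Proof.
have [[a ->] [b ->]] := (lclP x, lclP y).
by rewrite [k *: lcl a]lpaZE !lpaME [RHS]lpaZE; apply/lclE; apply: LR_mulZl.
Qed.
Fact lpaMZr (k : K) (x y : lpa_type) : lpaM x (k *: y) = k *: lpaM x y.
Proof.
have [[a ->] [b ->]] := (lclP x, lclP y).
by rewrite [k *: lcl b]lpaZE !lpaME [RHS]lpaZE; apply/lclE; apply: LR_mulZr.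
Qed.

Definition lpa_nuAlgebra : nuAlgebra K :=
  @NuAlgebra K lpa_type lpaM lpaMA lpaMDl lpaMDr lpaMZl lpaMZr.

Arguments lpa_nuAlgebra : simpl never.
Arguments nuM : simpl never.

Local Notation L := lpa_nuAlgebra.

(* the homogeneous components: the least family of subspaces such that the
   generators have their prescribed degrees and degrees add up in products *)
Inductive lpa_deg : int -> L -> Prop :=
  | LD_vertex v : lpa_deg 0 (lcl (LVertex v))
  | LD_edge e : lpa_deg 1 (lcl (LEdge e))
  | LD_ghost e : lpa_deg (-1) (lcl (LGhost e))
  | LD_zero n : lpa_deg n 0
  | LD_add n x y : lpa_deg n x -> lpa_deg n y -> lpa_deg n (x + y)
  | LD_scale n k x : lpa_deg n x -> lpa_deg n (k *: x)
  | LD_mul m n x y : lpa_deg m x -> lpa_deg n y -> lpa_deg (m + n) (nuM x y).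

Definition lpa1 : L := \sum_v lcl (LVertex v).

Lemma lcl_add a b : lcl (LAdd a b) = lcl a + lcl b :> L.
Proof. by rewrite [RHS]lpaDE. Qed.
Lemma lcl_opp a : lcl (LOpp a) = - lcl a :> L.
Proof. by rewrite [RHS]lpaNE. Qed.
Lemma lcl_scale k a : lcl (LScale k a) = k *: (lcl a : L).
Proof. by rewrite [RHS]lpaZE. Qed.
Lemma lcl_mul a b : lcl (LMul a b) = nuM (lcl a : L) (lcl b).
Proof. by rewrite [RHS]lpaME. Qed.
Lemma lcl_zero : lcl LZero = 0 :> L. Proof. by []. Qed.

Lemma lcl_sum (I : Type) (r : seq I) (F : I -> lpa_term) :
  lcl (foldr LAdd LZero [seq F i | i <- r]) = \sum_(i <- r) (lcl (F i) : L).
Proof.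
elim: r => [|i r IH]; first by rewrite big_nil.
by rewrite big_cons /= lcl_add IH.
Qed.

Lemma lcl_vertex v w : nuM (lcl (LVertex v) : L) (lcl (LVertex w)) =
  if v == w then lcl (LVertex v) else 0.
Proof.
rewrite -lcl_mul; have /lclE -> := LR_vertex v w.
by case: eqP.
Qed.

Lemma lpa1_absorb v (x : L) : nuM (lcl (LVertex v) : L) x = x -> nuM lpa1 x = x.
Proof.
move=> vx.
have nuM_suml (I : finType) (F : I -> L) (y : L) :
    nuM (\sum_i F i) y = \sum_i nuM (F i) y.
  exact: (big_morph (fun z : L => nuM z y) (fun a b => nuMDl a b y) (nuM0l y)).
rewrite nuM_suml (bigD1 v) // vx big1; first exact: addr0.
move=> w /andP[_ wv].
by rewrite -vx nuMA lcl_vertex (negbTE wv) nuM0l.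
Qed.

Lemma lpa_ind (Q : L -> Prop) :
  (forall v, Q (lcl (LVertex v))) -> (forall e, Q (lcl (LEdge e))) ->
  (forall e, Q (lcl (LGhost e))) -> Q 0 ->
  (forall x y, Q x -> Q y -> Q (x + y)) -> (forall k x, Q x -> Q (k *: x)) ->
  (forall x y, Q x -> Q y -> Q (nuM x y)) -> forall x, Q x.
Proof.
move=> Qv Qe Qg Q0 QD QZ QM x; have [a ->] := lclP x.
elim: a => // [a Ha b Hb|a Ha|k a Ha|a Ha b Hb].
- by rewrite lcl_add; apply: QD.
- by rewrite lcl_opp -scaleN1r; apply: QZ.
- by rewrite lcl_scale; apply: QZ.
- by rewrite lcl_mul; apply: QM.
Qed.

Lemma lpa1l (x : L) : nuM lpa1 x = x.
Proof.
elim/lpa_ind: x => [v|e|e||x y Hx Hy|k x Hx|x y Hx Hy].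
- by apply: (lpa1_absorb (v := v)); rewrite lcl_vertex eqxx.
- by apply: (lpa1_absorb (v := src e)); rewrite -lcl_mul; apply/lclE/LR_src.
- by apply: (lpa1_absorb (v := rng e)); rewrite -lcl_mul; apply/lclE/LR_ghost_rng.
- by rewrite nuM0r.
- by rewrite nuMDr Hx Hy.
- by rewrite nuMZr Hx.
- by rewrite nuMA Hx.
Qed.

Lemma lpa1_absorbr v (x : L) : nuM x (lcl (LVertex v) : L) = x -> nuM x lpa1 = x.
Proof.
move=> xv; rewrite -[in LHS]xv -nuMA.
suff -> : nuM (lcl (LVertex v) : L) lpa1 = lcl (LVertex v) by [].
rewrite (big_morph (nuM (lcl (LVertex v) : L)) (fun a b => nuMDr _ a b) (nuM0r _)).
rewrite (bigD1 v) // lcl_vertex eqxx big1; first exact: addr0.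
move=> w /andP[_ wv].
by rewrite lcl_vertex eq_sym (negbTE wv).
Qed.

Lemma lpa1r (x : L) : nuM x lpa1 = x.
Proof.
elim/lpa_ind: x => [v|e|e||x y Hx Hy|k x Hx|x y Hx Hy].
- by apply: (lpa1_absorbr (v := v)); rewrite lcl_vertex eqxx.
- by apply: (lpa1_absorbr (v := rng e)); rewrite -lcl_mul; apply/lclE/LR_rng.
- by apply: (lpa1_absorbr (v := src e)); rewrite -lcl_mul; apply/lclE/LR_ghost_src.
- by rewrite nuM0l.
- by rewrite nuMDl Hx Hy.
- by rewrite nuMZl Hx.
- by rewrite -nuMA Hy.
Qed.

(* L(E) acts on the sequences int -> L, a generator of degree n acting
   by multiplication followed by a shift by n; this separates the
   degrees. *)
Fixpoint lpa_opr (a : lpa_term) (g : int -> L) (m : int) : L :=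
  match a with
  | LVertex v => nuM (lcl (LVertex v) : L) (g m)
  | LEdge e => nuM (lcl (LEdge e) : L) (g (m - 1))
  | LGhost e => nuM (lcl (LGhost e) : L) (g (m + 1))
  | LZero => 0
  | LAdd a b => lpa_opr a g m + lpa_opr b g m
  | LOpp a => - lpa_opr a g m
  | LScale k a => k *: lpa_opr a g m
  | LMul a b => lpa_opr a (lpa_opr b g) m
  end.

Lemma lpa_oprD a g h m :
  lpa_opr a (fun n => g n + h n) m = lpa_opr a g m + lpa_opr a h m.
Proof.
elim: a g h m => [v|e|e||a Ha b Hb|a Ha|k a Ha|a Ha b Hb] g h m /=;
  rewrite ?addr0 //; do ?[exact: (nuMDr (_ : L))].
- by rewrite Ha Hb addrACA.
- by rewrite Ha opprD.
- by rewrite Ha scalerDr.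
- rewrite -Ha; congr (lpa_opr a _ m); apply/funext => n; exact: Hb.
Qed.

Lemma lpa_oprZ a k g m : lpa_opr a (fun n => k *: g n) m = k *: lpa_opr a g m.
Proof.
elim: a g m => [v|e|e||a Ha b Hb|a Ha|l a Ha|a Ha b Hb] g m /=;
  rewrite ?scaler0 //; do ?[exact: (nuMZr (n := L))].
- by rewrite Ha Hb scalerDr.
- by rewrite Ha scalerN.
- by rewrite Ha !scalerA mulrC.
- rewrite -Ha; congr (lpa_opr a _ m); apply/funext => n; exact: Hb.
Qed.

Lemma lpa_opr_rel a b : lpa_rel a b -> lpa_opr a = lpa_opr b.
Proof.
suff H : lpa_rel a b -> forall g m, lpa_opr a g m = lpa_opr b g m.
  by move=> ab; apply/funext => g; apply/funext => m; apply: H.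
elim=> {a b} /=.
- by [].
- by move=> a b _ H g m; rewrite H.
- by move=> a b c _ H _ H' g m; rewrite H H'.
- by move=> a a' b b' _ H _ H' g m; rewrite H H'.
- by move=> a a' _ H g m; rewrite H.
- by move=> k a a' _ H g m; rewrite H.
- move=> a a' b b' _ H _ H' g m; rewrite H; congr (lpa_opr a' _ m).
  by apply/funext => n; apply: H'.
- by move=> *; rewrite addrA.
- by move=> *; rewrite addrC.
- by move=> *; rewrite add0r.
- by move=> *; rewrite addNr.
- by move=> *; rewrite scalerA.
- by move=> *; rewrite scale1r.
- by move=> *; rewrite scalerDr.
- by move=> *; rewrite scalerDl.
- by [].
- by [].
- by move=> a b c g m; apply: lpa_oprD.
- by [].
- by move=> k a b g m; apply: lpa_oprZ.
- move=> v w g m; rewrite nuMA lcl_vertex; case: eqP => //= _.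
  by rewrite nuM0l.
- by move=> e g m; rewrite nuMA -lcl_mul; have /lclE -> := LR_src e.
- by move=> e g m; rewrite nuMA -lcl_mul; have /lclE -> := LR_rng e.
- by move=> e g m; rewrite nuMA -lcl_mul; have /lclE -> := LR_ghost_rng e.
- by move=> e g m; rewrite nuMA -lcl_mul; have /lclE -> := LR_ghost_src e.
- move=> e f g m; rewrite addrK nuMA -lcl_mul; have /lclE -> := LR_CK1 e f.
  by case: eqP => //= _; rewrite lcl_zero nuM0l.
- move=> v Hv g m; have /lclE -> := LR_CK2 Hv.
  elim: (enum _) => [|e r IH] /=; first by rewrite lcl_zero nuM0l.
  by rewrite lcl_add nuMDl IH lcl_mul subrK nuMA.
Qed.

Lemma lpa_opr_cl a : lpa_opr (repr (lcl a)) = lpa_opr a.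
Proof. by apply: lpa_opr_rel; apply: lcl_repr. Qed.

Definition lpa_proj (n : int) (x : L) : L :=
  lpa_opr (repr x) (fun m => if m == 0 then lpa1 else 0) n.

Lemma lpa_projD n x y : lpa_proj n (x + y) = lpa_proj n x + lpa_proj n y.
Proof.
have [[a ->] [b ->]] := (lclP x, lclP y).
by rewrite -lcl_add /lpa_proj !lpa_opr_cl.
Qed.

Lemma lpa_deg_opr n x : lpa_deg n x ->
  forall g m, lpa_opr (repr x) g m = nuM x (g (m - n)).
Proof.
elim=> {n x}.
- by move=> v g m; rewrite lpa_opr_cl subr0.
- by move=> e g m; rewrite lpa_opr_cl.
- by move=> e g m; rewrite lpa_opr_cl opprK.
- by move=> n g m; rewrite -[in LHS]lcl_zero lpa_opr_cl nuM0l.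
- move=> n x y _ Hx _ Hy g m; rewrite nuMDl -Hx -Hy.
  have [[a ->] [b ->]] := (lclP x, lclP y).
  by rewrite -lcl_add !lpa_opr_cl.
- move=> n k x _ Hx g m; rewrite nuMZl -Hx.
  by have [a ->] := lclP x; rewrite -lcl_scale !lpa_opr_cl.
- move=> p n x y _ Hx _ Hy g m; rewrite -nuMA opprD addrA.
  rewrite -(Hy g (m - p)) -(Hx (lpa_opr (repr y) g)).
  have [[a ->] [b ->]] := (lclP x, lclP y).
  by rewrite -lcl_mul !lpa_opr_cl.
Qed.

Fact lpa_grading : is_grading (lpa_deg : int -> set L).
Proof.
have Dspan (Q : L -> Prop) : Q 0 -> (forall x y, Q x -> Q y -> Q (x + y)) ->
    (forall n x, lpa_deg n x -> Q x) -> forall x, Q x.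
  move=> Q0 QD QG x.
  pose S y := exists s : seq L,
    y = \sum_(z <- s) z /\ forall z, z \in s -> exists n, lpa_deg n z.
  suff [s [-> Hs]] : S x.
    rewrite big_seq; elim/big_ind: _ => // z /Hs[n]; exact: QG.
  have S1 n y : lpa_deg n y -> S y.
    move=> Hy; exists [:: y]; split; first by rewrite big_seq1.
    by move=> z; rewrite inE => /eqP ->; exists n.
  have SD y z : S y -> S z -> S (y + z).
    move=> [s [-> Hs]] [t [-> Ht]]; exists (s ++ t); split; first by rewrite big_cat.
    by move=> u; rewrite mem_cat => /orP[/Hs|/Ht].
  have S0 : S 0 by apply: (S1 0); apply: LD_zero.
  have SZ k y : S y -> S (k *: y).
    move=> [s [-> Hs]]; rewrite scaler_sumr big_seq.
    elim/big_ind: _ => // z /Hs[n Hz]; apply: (S1 n); exact: LD_scale.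
  elim/lpa_ind: x => [v|e|e||y z Hy Hz|k y Hy|y z Hy Hz] //.
  - by apply: S1; apply: LD_vertex.
  - by apply: S1; apply: LD_edge.
  - by apply: S1; apply: LD_ghost.
  - exact: SD.
  - exact: SZ.
  - case: Hy Hz => s [-> Hs] [t [-> Ht]].
    rewrite (big_morph (fun u : L => nuM u (\sum_(z <- t) z))
      (fun a b => nuMDl a b _) (nuM0l _)) big_seq.
    elim/big_ind: _ => // u /Hs[m Hu].
    rewrite (big_morph (nuM u) (fun a b => nuMDr _ a b) (nuM0r _)) big_seq.
    elim/big_ind: _ => // w /Ht[n Hw].
    by apply: (S1 (m + n)); apply: LD_mul.
apply: (@grading_of_proj L _ lpa_proj) => //.
- exact: LD_zero.
- move=> n x y Hx Hy; apply: LD_add => //.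
  by rewrite -scaleN1r; apply: LD_scale.
- exact: lpa_projD.
- move=> n x m Hx; rewrite /lpa_proj (lpa_deg_opr Hx) subr_eq0.
  by case: eqP => _; [apply: lpa1r|apply: nuM0r].
Qed.

Definition leavitt : gAlgebra K :=
  @GAlgebra K lpa_nuAlgebra lpa_deg lpa_grading LD_scale LD_mul.

End Leavitt.

(* Main.v *)
From HB Require Import structures.
Require Import Defs.
From mathcomp Require Import all_boot all_order all_algebra.
From mathcomp Require Import boolp zify.

(** Write L for L(E), A for its unitization and v for a vertex.  The proof has
    two halves, which meet in the implication f(v) = 0 -> v = 0.

    Graded uniqueness ([graded_uniqueness]): a graded homomorphism f for which
    this implication holds at all vertices is injective.  L is exhausted by
    the finite-dimensional subspaces [level p q], spanned by the monomials
    a b^* with a of length at most p and |a| - |b| = p - q.  If x lies in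
    [level p q] and f(x) = 0, then v x w vanishes for all vertices v, w: when v
    emits edges, v x is the sum of the e (e^* x), and e^* x lies in
    [level p.-1 q] and is killed by f; likewise on the right; and when neither
    side can be shortened, v x w is a scalar multiple of v.

    The K-theoretic half.  Suppose f(v) = 0.  The graded right A-module v A is
    finitely generated projective, and v A (x) B = 0 along every ring map
    A -> B that kills v ([corner_extend0]).  Both the augmentation A -> Z and
    the map induced by f do, so the class of v A lies in K_0^gr(L) and in the
    kernel of K_0^gr(f).  By hypothesis it is zero, that is, v A + S is
    isomorphic to S for some finitely generated graded S.  It remains to see
    that S cannot absorb v A unless v = 0 ([direct_finiteness]).  The
    isomorphism provides endomorphisms w, r of S with w r = 1 and an element of
    ker w generating a copy of v A.  Let S be generated by homogeneous g_i of
    degrees d_i (after multiplying by the unit of L).  For large N the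
    subspaces sum_i g_i [level (N - d_i) N] contain that element, are
    finite-dimensional over K, and are stable under w and r, because
    [level p q] multiplied by [level q s] falls into [level p s] ([levelM]).
    In finite dimension a left inverse is injective
    ([kspan_retraction_inj]), so the element is zero, and hence so is v. *)

Set Implicit Arguments.
Unset Strict Implicit.
Unset Printing Implicit Defensive.

Import GRing.Theory.
Local Open Scope ring_scope.

(** * Finite spans under a possibly nonunital action of a field *)

(** The action is a bare map, not a module structure: on a graded A-module, K
    acts through the elements k 1_L of A, and 1 acts as an idempotent. *)
Inductive kspan (K : fieldType) (V : zmodType) (act : K -> V -> V)
    (G : V -> Prop) : V -> Prop :=
  | kspan0 : kspan act G 0
  | kspanD x y : kspan act G x -> kspan act G y -> kspan act G (x + y)
  | kspanZ k x : G x -> kspan act G (act k x).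

Lemma kspan_map (K : fieldType) (V W : zmodType) (actV : K -> V -> V)
    (actW : K -> W -> W) (G : V -> Prop) (H : W -> Prop) (F : V -> W) :
  (forall x y, F (x + y) = F x + F y) ->
  (forall k x, F (actV k x) = actW k (F x)) ->
  (forall x, G x -> H (F x)) ->
  forall x, kspan actV G x -> kspan actW H (F x).
Proof.
move=> FD FZ FG x; elim=> [|y z _ Hy _ Hz|k y Gy].
- have -> : F 0 = 0 by apply: (addrI (F 0)); rewrite -FD !addr0.
  exact: kspan0.
- by rewrite FD; apply: kspanD.
- by rewrite FZ; apply/kspanZ/FG.
Qed.

Lemma kspan_sum (K : fieldType) (V : zmodType) (act : K -> V -> V)
    (G : V -> Prop) (I : finType) (F : I -> V) :
  (forall i, kspan act G (F i)) -> kspan act G (\sum_i F i).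
Proof.
by move=> FG; elim/big_ind: _ => //; [apply: kspan0|apply: kspanD].
Qed.

Lemma kspanZ_closed (K : fieldType) (V : lmodType K) (G : V -> Prop) k x :
  kspan *:%R G x -> kspan *:%R G (k *: x).
Proof.
elim=> [|y z _ Hy _ Hz|l y Gy].
- by rewrite scaler0; apply: kspan0.
- by rewrite scalerDr; apply: kspanD.
- by rewrite scalerA; apply: kspanZ.
Qed.

Section FiniteSpan.
Variables (K : fieldType) (V : zmodType) (act : K -> V -> V).
Hypotheses (actDl : forall k l x, act (k + l) x = act k x + act l x)
  (actDr : forall k x y, act k (x + y) = act k x + act k y)
  (actA : forall k l x, act k (act l x) = act (k * l) x).

Let act0l x : act 0 x = 0.
Proof. by apply: (addrI (act 0 x)); rewrite -actDl !addr0. Qed.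
Let act0r k : act k 0 = 0.
Proof. by apply: (addrI (act k 0)); rewrite -actDr !addr0. Qed.

Definition lincomb m (b : 'I_m -> V) (c : 'rV[K]_m) : V :=
  \sum_i act (c 0 i) (b i).

Lemma lincombD m (b : 'I_m -> V) c d :
  lincomb b (c + d) = lincomb b c + lincomb b d.
Proof. by rewrite -big_split; apply: eq_bigr => i _; rewrite mxE actDl. Qed.

Lemma lincombZ m (b : 'I_m -> V) k c : lincomb b (k *: c) = act k (lincomb b c).
Proof.
rewrite /lincomb (big_morph (act k) (actDr k) (act0r k)).
by apply: eq_bigr => i _; rewrite mxE actA.
Qed.

Lemma lincomb0 m (b : 'I_m -> V) : lincomb b 0 = 0.
Proof. by rewrite /lincomb big1 // => i _; rewrite mxE act0l. Qed.

Lemma lincombB m (b : 'I_m -> V) c d :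
  lincomb b (c - d) = lincomb b c - lincomb b d.
Proof.
by apply/eqP; rewrite eq_sym subr_eq -lincombD subrK.
Qed.

Lemma lincomb_delta m (b : 'I_m -> V) i :
  lincomb b (delta_mx 0 i) = act 1 (b i).
Proof.
rewrite /lincomb (bigD1 i) //= mxE !eqxx big1 ?addr0 // => j ji.
by rewrite mxE (negbTE ji) andbF act0l.
Qed.

Lemma lincomb_mulmx m (b : 'I_m -> V) n (c : 'rV[K]_n) (M : 'M[K]_(n, m)) :
  lincomb b (c *m M) = lincomb (fun i => lincomb b (row i M)) c.
Proof.
rewrite [RHS]/lincomb mulmx_sum_row.
rewrite (big_morph (lincomb b) (@lincombD m b) (@lincomb0 m b)).
by apply: eq_bigr => i _; rewrite lincombZ.
Qed.

(** Adding the elements of s one at a time, a new one is kept only if it is not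
    a combination of those already chosen. *)
Lemma kspan_basis (s : seq V) : (forall x, x \in s -> act 1 x = x) ->
  exists m (b : 'I_m -> V),
    [/\ forall i, b i \in s, forall c, lincomb b c = 0 -> c = 0
      & forall y, kspan act (fun x => x \in s) y -> exists c, y = lincomb b c].
Proof.
elim: s => [|x s IH] act1.
  exists 0, (fun=> 0); split=> [[]|c _|y] //; first by apply/rowP => -[].
  elim=> [|y1 y2 _ [c ->] _ [d ->]|//]; first by exists 0; rewrite lincomb0.
  by exists (c + d); rewrite lincombD.
have [m [b [bs bfree bspan]]] : exists m (b : 'I_m -> V),
    [/\ forall i, b i \in s, forall c, lincomb b c = 0 -> c = 0
      & forall y, kspan act (fun x => x \in s) y -> exists c, y = lincomb b c].
  by apply: IH => y ys; apply: act1; rewrite inE ys orbT.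
have [[d xd]|xb] := EM (exists d, x = lincomb b d).
  exists m, b; split=> // [i|y]; first by rewrite inE bs orbT.
  elim=> [|y1 y2 _ [c1 ->] _ [c2 ->]|k y1].
  - by exists 0; rewrite lincomb0.
  - by exists (c1 + c2); rewrite lincombD.
  - rewrite inE => /orP[/eqP ->|y1s].
      by exists (k *: d); rewrite lincombZ -xd.
    by apply: bspan; apply: kspanZ.
pose b' (i : 'I_m.+1) := oapp b x (unlift ord0 i).
have b'0 : b' ord0 = x by rewrite /b' unlift_none.
have b'S i : b' (lift ord0 i) = b i by rewrite /b' liftK.
have b'E c : lincomb b' c
    = act (c 0 0) x + lincomb b (\row_i c 0 (lift ord0 i)).
  rewrite /lincomb big_ord_recl b'0; congr (_ + _).
  by apply: eq_bigr => i _; rewrite b'S mxE.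
have b'ext (c : 'rV[K]_m) k : lincomb b' (\row_i oapp (c 0) k (unlift ord0 i))
    = act k x + lincomb b c.
  rewrite b'E mxE unlift_none /=; congr (_ + lincomb _ _).
  by apply/rowP => i; rewrite !mxE liftK.
exists m.+1, b'; split.
- move=> i; case: (unliftP ord0 i) => [j ->|->]; last by rewrite b'0 mem_head.
  by rewrite b'S inE bs orbT.
- move=> c; rewrite b'E => c0.
  have c00 : c 0 0 = 0.
    apply/eqP; apply: contra_notT xb => cn0.
    exists (- (c 0 0)^-1 *: \row_i c 0 (lift ord0 i)).
    move/eqP: c0; rewrite addrC addr_eq0 => /eqP c0.
    have xE : x = act (c 0 0)^-1 (act (c 0 0) x).
      by rewrite actA mulVf // act1 ?mem_head.
    have actN k y : act (- k) y = - act k y.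
      by apply: (addrI (act k y)); rewrite -actDl !subrr act0l.
    rewrite lincombZ c0 actN.
    have -> : act (c 0 0)^-1 (- act (c 0 0) x) = - act (c 0 0)^-1 (act (c 0 0) x).
      by rewrite -actN !actA mulrN actN.
    by rewrite opprK -xE.
  move: c0; rewrite c00 act0l add0r => /bfree/rowP cl.
  apply/rowP => i; rewrite [RHS]mxE; case: (unliftP ord0 i) => [j ->|->//].
  by have := cl j; rewrite !mxE.
- move=> y; elim=> [|y1 y2 _ [c1 ->] _ [c2 ->]|k y1].
  + by exists 0; rewrite lincomb0.
  + by exists (c1 + c2); rewrite lincombD.
  + rewrite inE => /orP[/eqP ->|y1s].
      exists (\row_i oapp ((0 : 'rV[K]_m) 0) k (unlift ord0 i)).
      by rewrite b'ext lincomb0 addr0.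
    have [c cE] : exists c, act k y1 = lincomb b c by apply/bspan/kspanZ.
    by exists (\row_i oapp (c 0) 0 (unlift ord0 i)); rewrite b'ext act0l add0r.
Qed.

(** On a basis of the span, w and r become square matrices W and T with
    T W = 1, so that W T = 1 as well. *)
Lemma kspan_retraction_inj (s : seq V) (w r : V -> V) :
  (forall x, x \in s -> act 1 x = x) ->
  (forall x y, w (x + y) = w x + w y) -> (forall k x, w (act k x) = act k (w x)) ->
  (forall x y, r (x + y) = r x + r y) -> (forall k x, r (act k x) = act k (r x)) ->
  (forall x, x \in s -> kspan act (fun y => y \in s) (w x)) ->
  (forall x, x \in s -> kspan act (fun y => y \in s) (r x)) ->
  (forall x, w (r x) = x) ->
  forall x, kspan act (fun y => y \in s) x -> w x = 0 -> x = 0.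
Proof.
move=> act1 wD wZ rD rZ ws rs wr x xs.
have [m [b [bs bfree bspan]]] := kspan_basis act1.
have mx (u : V -> V) : (forall x y, u (x + y) = u x + u y) ->
    (forall k x, u (act k x) = act k (u x)) ->
    (forall x, x \in s -> kspan act (fun y => y \in s) (u x)) ->
    exists M : 'M[K]_m, forall c, u (lincomb b c) = lincomb b (c *m M).
  move=> uD uZ us.
  have [F FP] := fin_all_exists (fun i => bspan _ (us _ (bs i))).
  exists (\matrix_i F i) => c; rewrite lincomb_mulmx.
  have u0 : u 0 = 0 by apply: (addrI (u 0)); rewrite -uD !addr0.
  rewrite /lincomb (big_morph u uD u0); apply: eq_bigr => i _.
  by rewrite uZ rowK FP.
have [W wE] := mx w wD wZ ws; have [T rE] := mx r rD rZ rs.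
have TW : T *m W = 1%:M.
  apply/row_matrixP => i; rewrite rowE [RHS]rowE mulmx1 mulmxA.
  apply/eqP; rewrite -subr_eq0; apply/eqP/bfree.
  by rewrite lincombB -wE -rE wr subrr.
have [c ->] := bspan _ xs; rewrite wE => /bfree cW0.
by rewrite -[c]mulmx1 -(mulmx1C TW) mulmxA cW0 mul0mx lincomb0.
Qed.

End FiniteSpan.

(** * The filtration of a Leavitt path algebra and graded uniqueness *)

Lemma nuM_suml (K : fieldType) (A : nuAlgebra K) (I : finType) (F : I -> A) y :
  nuM (\sum_i F i) y = \sum_i nuM (F i) y.
Proof. exact: (big_morph (fun z => nuM z y) (fun a b => nuMDl a b y) (nuM0l y)). Qed.

Lemma nuM_sumr (K : fieldType) (A : nuAlgebra K) (I : finType) (F : I -> A) x :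
  nuM x (\sum_i F i) = \sum_i nuM x (F i).
Proof. exact: (big_morph (nuM x) (fun a b => nuMDr x a b) (nuM0r x)). Qed.

Section Levels.
Variables (K : fieldType) (E : finGraph).
Local Notation L := (leavitt K E).

Definition vtx (v : vertex E) : L := lcl (LVertex K v).
Definition edg (e : edge E) : L := lcl (LEdge K e).
Definition gho (e : edge E) : L := lcl (LGhost K e).
Definition sink (v : vertex E) : bool := [forall e, src e != v].

Lemma vtxM v w : nuM (vtx v) (vtx w) = if v == w then vtx v else 0.
Proof. exact: lcl_vertex. Qed.

Lemma vtx_edg v e : nuM (vtx v) (edg e) = if v == src e then edg e else 0.
Proof.
have srcE : nuM (vtx (src e)) (edg e) = edg e.
  by rewrite -[LHS]lcl_mul; apply/lclE/LR_src.
by rewrite -srcE nuMA vtxM; case: eqP => [->|_] //; rewrite nuM0l.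
Qed.

Lemma gho_vtx e v : nuM (gho e) (vtx v) = if src e == v then gho e else 0.
Proof.
have srcE : nuM (gho e) (vtx (src e)) = gho e.
  by rewrite -[LHS]lcl_mul; apply/lclE/LR_ghost_src.
by rewrite -[in LHS]srcE -nuMA vtxM; case: eqP; rewrite ?nuM0r.
Qed.

Lemma edg_rng e : nuM (edg e) (vtx (rng e)) = edg e.
Proof. by rewrite -[LHS]lcl_mul; apply/lclE/LR_rng. Qed.

Lemma rng_gho e : nuM (vtx (rng e)) (gho e) = gho e.
Proof. by rewrite -[LHS]lcl_mul; apply/lclE/LR_ghost_rng. Qed.

Lemma gho_edg e f : nuM (gho e) (edg f) = if e == f then vtx (rng e) else 0.
Proof.
rewrite -[LHS]lcl_mul; have /lclE -> := LR_CK1 K e f.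
by case: eqP.
Qed.

Lemma vtx_nonsink v : ~~ sink v ->
  vtx v = \sum_(e | src e == v) nuM (edg e) (gho e).
Proof.
rewrite negb_forall => /existsP[e]; rewrite negbK => ev.
have /LR_CK2-/(_ K) /lclE : (0 < #|[set e | src e == v]|)%N.
  by apply/card_gt0P; exists e; rewrite inE.
rewrite /vtx => ->; rewrite [LHS]lcl_sum big_enum.
apply: eq_big => [f|f _]; first by rewrite inE.
by rewrite lcl_mul.
Qed.

Lemma lpa_unit_decomp (x : L) : x = \sum_v nuM (vtx v) x.
Proof. by rewrite -nuM_suml -[LHS]lpa1l. Qed.

Lemma lpa_unit_decompr (x : L) : x = \sum_v nuM x (vtx v).
Proof. by rewrite -nuM_sumr -[LHS]lpa1r. Qed.

(** [level p q] is the span of the a b^* with |a| <= p and |a| - |b| = p - q.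
    Since v is in all the [level p p], both bounds may be raised together.
    Recording the second bound q is what makes the product below exact:
    the levels multiply like matrix units. *)
Inductive level : nat -> nat -> L -> Prop :=
  | level_vtx p v : level p p (vtx v)
  | level_edg p q e x : level p q x -> level p.+1 q (nuM (edg e) x)
  | level_gho p q e x : level p q x -> level p q.+1 (nuM x (gho e))
  | level0 p q : level p q 0
  | levelD p q x y : level p q x -> level p q y -> level p q (x + y)
  | levelZ p q k x : level p q x -> level p q (k *: x).

Lemma level_sum p q (I : finType) (F : I -> L) :
  (forall i, level p q (F i)) -> level p q (\sum_i F i).
Proof. by move=> FG; elim/big_ind: _ => //; [apply: level0|apply: levelD]. Qed.

Lemma level_vtxl p q v x : level p q x -> level p q (nuM (vtx v) x).
Proof.
elim=> {p q x} [p w|p q e x H _|p q e x _ H|p q|p q x y _ Hx _ Hy|p q k x _ H].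
- by rewrite vtxM; case: eqP => _; [apply: level_vtx|apply: level0].
- rewrite nuMA vtx_edg; case: eqP => _; first exact: level_edg.
  by rewrite nuM0l; apply: level0.
- by rewrite nuMA; apply: level_gho.
- by rewrite nuM0r; apply: level0.
- by rewrite nuMDr; apply: levelD.
- by rewrite nuMZr; apply: levelZ.
Qed.

Lemma level_vtxr p q v x : level p q x -> level p q (nuM x (vtx v)).
Proof.
elim=> {p q x} [p w|p q e x _ H|p q e x H _|p q|p q x y _ Hx _ Hy|p q k x _ H].
- by rewrite vtxM; case: eqP => _; [apply: level_vtx|apply: level0].
- by rewrite -nuMA; apply: level_edg.
- rewrite -nuMA gho_vtx; case: eqP => _; first exact: level_gho.
  by rewrite nuM0r; apply: level0.
- by rewrite nuM0l; apply: level0.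
- by rewrite nuMDl; apply: levelD.
- by rewrite nuMZl; apply: levelZ.
Qed.

(** e^* cancels the first edge of a monomial; when there is none to cancel, it
    lengthens the ghost part, and e^* = r(e) e^* is still in the span because
    the bound p.+1 left room. *)
Lemma level_ghol p q e x : level p.+1 q x -> level p q (nuM (gho e) x).
Proof.
suff gen p' y : level p' q y -> forall p, p' = p.+1 -> level p q (nuM (gho e) y).
  by move=> Hx; apply: gen Hx _ erefl.
elim=> {p x p' q y}
  [_ v p ->|p' q f x H _ p [<-]|p' q f x _ IH p pE|p' q p _
    |p' q x y _ Hx _ Hy p pE|p' q k x _ H p pE].
- rewrite gho_vtx; case: eqP => _; last exact: level0.
  by rewrite -rng_gho; apply/level_gho/level_vtx.
- rewrite nuMA gho_edg; case: eqP => _; first exact: level_vtxl.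
  by rewrite nuM0l; apply: level0.
- by rewrite nuMA; apply/level_gho/IH.
- by rewrite nuM0r; apply: level0.
- by rewrite nuMDr; apply: levelD; [apply: Hx|apply: Hy].
- by rewrite nuMZr; apply/levelZ/H.
Qed.

Lemma level_ghor p q e x : level p q.+1 x -> level p q (nuM x (edg e)).
Proof.
suff gen q' y : level p q' y -> forall q, q' = q.+1 -> level p q (nuM y (edg e)).
  by move=> Hx; apply: gen Hx _ erefl.
elim=> {q x q' p y}
  [_ v q ->|p q' f x _ IH q qE|p q' f x H _ q [<-]|p q' q _
    |p q' x y _ Hx _ Hy q qE|p q' k x _ H q qE].
- rewrite vtx_edg; case: eqP => _; last exact: level0.
  by rewrite -edg_rng; apply/level_edg/level_vtx.
- by rewrite -nuMA; apply/level_edg/IH.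
- rewrite -nuMA gho_edg; case: eqP => _; first exact: level_vtxr.
  by rewrite nuM0r; apply: level0.
- by rewrite nuM0l; apply: level0.
- by rewrite nuMDl; apply: levelD; [apply: Hx|apply: Hy].
- by rewrite nuMZl; apply/levelZ/H.
Qed.

Lemma levelM p q r x y : level p q x -> level q r y -> level p r (nuM x y).
Proof.
move=> H; elim: H r y => {p q x}
  [p v|p q e x _ IH|p q e x _ IH|p q|p q x y _ Hx _ Hy|p q k x _ H] r z Hz.
- exact: level_vtxl.
- by rewrite -nuMA; apply/level_edg/IH.
- by rewrite -nuMA; apply/IH/level_ghol.
- by rewrite nuM0l; apply: level0.
- by rewrite nuMDl; apply: levelD; [apply: Hx|apply: Hy].
- by rewrite nuMZl; apply/levelZ/H.
Qed.

(** The argument n is fuel: it only has to exceed p + q. *)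
Fixpoint level_gens (n p q : nat) : seq L :=
  if n is n'.+1 then
    (if p == q then [seq vtx v | v <- enum (vertex E)] else [::]) ++
    (if p is p'.+1 then
       [seq nuM (edg e) x | e <- enum (edge E), x <- level_gens n' p' q]
     else [::]) ++
    (if q is q'.+1 then
       [seq nuM x (gho e) | e <- enum (edge E), x <- level_gens n' p q']
     else [::])
  else [::].

Lemma level_gens_level n p q x : x \in level_gens n p q -> level p q x.
Proof.
elim: n p q x => [//|n IH] p q x /=; rewrite !mem_cat => /or3P[].
- case: eqP => // -> /mapP[v _ ->]; exact: level_vtx.
- by case: p => // p /allpairsP[[e y] [_ /IH Hy ->]]; apply: level_edg.
- by case: q => // q /allpairsP[[e y] [_ /IH Hy ->]]; apply: level_gho.
Qed.

Lemma level_finite n p q x : (p + q < n)%N -> level p q x ->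
  kspan *:%R (fun y => y \in level_gens n p q) x.
Proof.
move=> pqn H; elim: H n pqn => {p q x}
  [p v|p q e x _ IH|p q e x _ IH|p q|p q x y _ Hx _ Hy|p q k x _ H] [//|n] pqn.
- rewrite -[vtx v]scale1r; apply: kspanZ.
  by rewrite /= eqxx mem_cat map_f ?mem_enum.
- have /IH : (p + q < n)%N by rewrite addSn in pqn.
  apply: (kspan_map (F := nuM (edg e))) => [y z|k y|y Hy].
  + exact: nuMDr.
  + exact: nuMZr.
  + rewrite !mem_cat; apply/orP; right; apply/orP; left.
    by apply/allpairsP; exists (e, y); rewrite mem_enum.
- have /IH : (p + q < n)%N by rewrite addnS in pqn.
  apply: (kspan_map (F := fun y => nuM y (gho e))) => [y z|k y|y Hy].
  + exact: nuMDl.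
  + exact: nuMZl.
  + rewrite !mem_cat; apply/orP; right; apply/orP; right.
    by apply/allpairsP; exists (e, y); rewrite mem_enum.
- exact: kspan0.
- by apply: kspanD; [apply: Hx|apply: Hy].
- by apply/kspanZ_closed/H.
Qed.

(** The sum of two degrees comes from a product through an intermediate bound
    q + n, which is a natural number as soon as q is large. *)
Lemma homogeneous_level n x : ga_deg n x ->
  exists N : nat, forall p q : nat, p%:Z - q%:Z = n -> (N <= q)%N -> level p q x.
Proof.
elim=> {n x}.
- move=> v; exists 0%N => p q pq _; have -> : p = q by lia.
  exact: level_vtx.
- move=> e; exists 0%N => p q pq _; have -> : p = q.+1 by lia.
  by rewrite -[lcl _]edg_rng; apply/level_edg/level_vtx.
- move=> e; exists 0%N => p q pq _; have -> : q = p.+1 by lia.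
  by rewrite -[lcl _]rng_gho; apply/level_gho/level_vtx.
- by move=> n; exists 0%N => p q _ _; apply: level0.
- move=> n x y _ [M HM] _ [N HN]; exists (M + N)%N => p q pq qMN.
  by apply: levelD; [apply: HM|apply: HN] => //; lia.
- move=> n k x _ [N HN]; exists N => p q pq qN.
  by apply/levelZ/HN.
- move=> m n x y _ [M HM] _ [N HN].
  exists (M + N + absz n)%N => p q pq Hq.
  by apply: (levelM (q := absz (q%:Z + n))); [apply: HM|apply: HN]; lia.
Qed.


Lemma homogeneous_level_uniform (J : finType) (D : J -> int) (c : J -> L) :
  (forall j, ga_deg (D j) (c j)) -> exists N : nat, forall j (p q : nat),
    p%:Z - q%:Z = D j -> (N <= q)%N -> level p q (c j).
Proof.
move=> Dc; have [F FP] := fin_all_exists (fun j => homogeneous_level (Dc j)).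
exists (\max_j F j)%N => j p q pq qF; apply: FP => //.
exact: leq_trans (leq_bigmax j) qF.
Qed.

(** Where the left side cannot be shortened (p = 0, or v emits no edges) nor the
    right side, no monomial with a real or ghost edge survives in v x w. *)
Lemma level_corner p q v w x : level p q x ->
  (p == 0)%N || sink v -> (q == 0)%N || sink w ->
  exists k, nuM (nuM (vtx v) x) (vtx w) = k *: vtx v.
Proof.
elim=> {p q x}
  [p u|p q e x _ _|p q e x _ _|p q|p q x y _ Hx _ Hy|p q k x _ H] pv qw.
- rewrite vtxM; case: eqP => _; last by exists 0; rewrite nuM0l scale0r.
  rewrite vtxM; case: eqP => _; last by exists 0; rewrite scale0r.
  by exists 1; rewrite scale1r.
- exists 0; rewrite scale0r nuMA vtx_edg eq_sym (negbTE (forallP pv e)).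
  by rewrite !nuM0l.
- exists 0; rewrite scale0r nuMA -nuMA gho_vtx (negbTE (forallP qw e)).
  by rewrite nuM0r.
- by exists 0; rewrite nuM0r nuM0l scale0r.
- have [[k kE] [l lE]] := (Hx pv qw, Hy pv qw).
  by exists (k + l); rewrite nuMDr nuMDl kE lE scalerDl.
- have [l lE] := H pv qw.
  by exists (k * l); rewrite nuMZr nuMZl lE scalerA.
Qed.

Section Uniqueness.
Variables (R : gAlgebra K) (f : gAlgHom L R).
Hypothesis f_vtx : forall v, f (vtx v) = 0 -> vtx v = 0.

(** Multiplying by e^* on the left or by e on the right lowers p + q and stays
    in the kernel of f; the relation v = sum e e^* recovers x. *)
Lemma hom_level_inj n p q x : (p + q < n)%N -> level p q x -> f x = 0 -> x = 0.
Proof.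
elim: n p q x => [//|n IH] p q x pqn Hx fx.
rewrite [x]lpa_unit_decompr big1 // => w _; rewrite [x]lpa_unit_decomp nuM_suml.
rewrite big1 // => v _.
case: (boolP ((p == 0)%N || sink v)) => [pv|]; last first.
  rewrite negb_or; case: p pqn Hx => // p pqn Hx /andP[_ /vtx_nonsink ->].
  rewrite !(big_morph (fun z => nuM z _) (fun a b => nuMDl a b _) (nuM0l _)).
  rewrite big1 // => e _; rewrite -(nuMA (edg e)) (IH p q (nuM (gho e) x)) ?nuM0r ?nuM0l //.
    exact: level_ghol.
  by rewrite gahM fx nuM0r.
case: (boolP ((q == 0)%N || sink w)) => [qw|]; last first.
  rewrite negb_or; case: q pqn Hx => // q pqn Hx /andP[_ /vtx_nonsink ->].
  rewrite (big_morph (nuM _) (fun a b => nuMDr _ a b) (nuM0r _)).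
  rewrite big1 // => e _; rewrite nuMA -(nuMA (vtx v)).
  rewrite (IH p q (nuM x (edg e))) ?nuM0r ?nuM0l //; first by lia.
    exact: level_ghor.
  by rewrite gahM fx nuM0l.
have [k kE] := level_corner Hx pv qw; rewrite kE.
have kf : k *: f (vtx v) = 0 by rewrite -linearZ -kE !gahM fx nuM0r nuM0l.
have [k0|k0] := eqVneq k 0; first by rewrite k0 scale0r.
rewrite f_vtx ?scaler0 //.
by rewrite -[LHS]scale1r -(mulVf k0) -scalerA kf scaler0.
Qed.

Lemma graded_uniqueness : injective f.
Proof.
suff f0 x : f x = 0 -> x = 0.
  move=> x y fxy; apply/subr0_eq/f0; apply: etrans (raddfB f x y) _.
  by apply/eqP; rewrite subr_eq0; apply/eqP.
move=> fx; rewrite [x](gcomp_sum (ga_grading L)) big1_seq // => n /andP[_ nx].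
have [N HN] := homogeneous_level (gcompP (ga_grading L) n x).
apply: (hom_level_inj (n := (absz (N%:Z + (absz n)%:Z + n)%R + (N + absz n)).+1%N)
  (p := absz (N%:Z + (absz n)%:Z + n)) (q := (N + absz n)%N)) => //.
  by apply: HN; lia.
apply: (grading_free (ga_grading R) (s := gsupp (ga_grading L) x)
  (c := fun m => f (gcomp (ga_grading L) m x))) => //; last first.
- apply: etrans (esym (raddf_sum f _ _ _)) _.
  by rewrite -gcomp_sum.
- by move=> m; apply: gah_deg; apply: (gcompP (ga_grading L) m x).
- exact: gsupp_uniq.
Qed.

End Uniqueness.

End Levels.

(** * The module eA of a homogeneous idempotent *)

Lemma gcomp_hom (A : gRing) (M N : gModule A) (h : gModHom M N) n x :
  h (gcomp (gm_grading M) n x) = gcomp (gm_grading N) n (h x).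
Proof.
apply: esym.
apply: (@gcomp_uniq _ _ (gm_grading N) (gsupp (gm_grading M) x)
  (fun n => h (gcomp (gm_grading M) n x))).
- exact: gsupp_uniq.
- by move=> k; apply: gmh_deg; apply: (gcompP (gm_grading M) k x).
- by move=> k kx; rewrite gcomp_out // raddf0.
- by rewrite [in LHS](gcomp_sum (gm_grading M) x) raddf_sum.
Qed.

Section Corner.
Variables (A : gRing) (e : A).
Hypotheses (e_idem : e * e = e) (e_deg : gr_deg 0 e).

(** The right ideal e A, as the set of fixed points of the multiplication by e;
    the operations are carried over from A through the projection x |-> e x. *)
Definition corner : Type := {x : A | e * x == x}.
HB.instance Definition _ := SubType.on corner.
HB.instance Definition _ := [Choice of corner by <:].

Fact corner_mem x : e * (e * x) == e * x.
Proof. by rewrite mulrA e_idem. Qed.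

Definition corner_proj (x : A) : corner :=
  exist (fun x => e * x == x) (e * x) (corner_mem x).

Lemma cornerP (x : corner) : e * val x = val x.
Proof. exact/eqP/(valP x). Qed.

Lemma corner_projK (x : corner) : corner_proj (val x) = x.
Proof. by apply/val_inj/cornerP. Qed.

Definition corner_add (x y : corner) := corner_proj (val x + val y).
Definition corner_opp (x : corner) := corner_proj (- val x).
Definition corner_scale (a : A^c) (x : corner) := corner_proj (val x * (a : A)).

Lemma corner_addE x y : val (corner_add x y) = val x + val y.
Proof. by rewrite /= mulrDr !cornerP. Qed.
Lemma corner_oppE x : val (corner_opp x) = - val x.
Proof. by rewrite /= mulrN cornerP. Qed.
Lemma corner_scaleE (a : A) x : val (corner_scale a x) = val x * a.
Proof. by rewrite /= mulrA cornerP. Qed.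
Lemma corner0E : val (corner_proj 0) = 0.
Proof. by rewrite /= mulr0. Qed.

Fact corner_addA : associative corner_add.
Proof. by move=> x y z; apply: val_inj; rewrite !corner_addE addrA. Qed.
Fact corner_addC : commutative corner_add.
Proof. by move=> x y; apply: val_inj; rewrite !corner_addE addrC. Qed.
Fact corner_add0 : left_id (corner_proj 0) corner_add.
Proof. by move=> x; apply: val_inj; rewrite corner_addE corner0E add0r. Qed.
Fact corner_addN : left_inverse (corner_proj 0) corner_opp corner_add.
Proof.
by move=> x; apply: val_inj; rewrite corner_addE corner_oppE corner0E addNr.
Qed.

HB.instance Definition _ :=
  GRing.isZmodule.Build corner corner_addA corner_addC corner_add0 corner_addN.

Fact corner_scaleA a b x :
  corner_scale a (corner_scale b x) = corner_scale (a * b) x.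
Proof. by apply: val_inj; rewrite !corner_scaleE -mulrA. Qed.
Fact corner_scale1 : left_id 1 corner_scale.
Proof. by move=> x; apply: val_inj; rewrite corner_scaleE [LHS]mulr1. Qed.
Fact corner_scaleDr : right_distributive corner_scale +%R.
Proof.
move=> a x y; apply: val_inj; rewrite corner_scaleE.
by rewrite !corner_addE !corner_scaleE mulrDl.
Qed.
Fact corner_scaleDl x : {morph corner_scale^~ x : a b / a + b}.
Proof.
move=> a b; apply: val_inj.
by rewrite corner_scaleE corner_addE !corner_scaleE [LHS]mulrDr.
Qed.

HB.instance Definition _ := GRing.Zmodule_isLmodule.Build A^c corner
  corner_scaleA corner_scale1 corner_scaleDr corner_scaleDl.

Lemma val_cornerD (x y : corner) : val (x + y) = val x + val y.
Proof. exact: corner_addE. Qed.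
Lemma val_cornerN (x : corner) : val (- x) = - val x.
Proof. exact: corner_oppE. Qed.
Lemma val_corner0 : val (0 : corner) = 0.
Proof. exact: corner0E. Qed.
Lemma val_cornerZ (a : A) (x : corner) : val ((a : A^c) *: x) = val x * a.
Proof. exact: corner_scaleE. Qed.
Lemma corner_projD x y : corner_proj (x + y) = corner_proj x + corner_proj y.
Proof. by apply: val_inj; rewrite val_cornerD /= mulrDr. Qed.
Lemma corner_proj0 : corner_proj 0 = 0.
Proof. by []. Qed.

Definition corner_deg (n : int) : classical_sets.set corner :=
  fun x => gr_deg n (val x).

Let HA := gr_grading A.

Lemma corner_proj_deg n x : gr_deg n x -> corner_deg n (corner_proj x).
Proof. by move=> Hx; rewrite -[n]add0r; apply: gr_degM. Qed.

Fact corner_grading : is_grading corner_deg.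
Proof.
apply: (@grading_of_proj corner corner_deg (fun n x => corner_proj (gcomp HA n (val x)))).
- by move=> n; rewrite /corner_deg val_corner0; apply: grading0 HA n.
- move=> n x y Hx Hy; rewrite /corner_deg val_cornerD val_cornerN.
  exact: gradingB.
- by move=> n x y; rewrite val_cornerD gcompD corner_projD.
- move=> n x m Hx; rewrite (gcomp_id HA m Hx).
  by case: eqP => _; rewrite ?corner_projK ?corner_proj0.
- move=> Q Q0 QD QG x; rewrite -[x]corner_projK.
  apply: (grading_ind HA (Q := fun y => Q (corner_proj y))).
  + by rewrite corner_proj0.
  + by move=> y z Hy Hz; rewrite corner_projD; apply: QD.
  + by move=> n y Hy; apply: (QG n); apply: corner_proj_deg.
Qed.

Fact corner_degZ m n (x : corner) (a : A) :
  corner_deg m x -> gr_deg n a -> corner_deg (m + n) ((a : A^c) *: x).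
Proof. by move=> Hx Ha; rewrite /corner_deg val_cornerZ; apply: gr_degM. Qed.

Definition gcorner : gModule A := @GModule A corner _ corner_grading corner_degZ.

Definition corner_gen : gcorner := corner_proj 1.

Lemma corner_genE (x : gcorner) : x = ((val x : A) : A^c) *: corner_gen.
Proof. by apply: val_inj; rewrite val_cornerZ /= mulr1 cornerP. Qed.

Lemma corner_gen_idem : ((e : A) : A^c) *: corner_gen = corner_gen.
Proof. by apply: val_inj; rewrite val_cornerZ /= mulr1. Qed.

Lemma corner_gen_deg : gm_deg 0 corner_gen.
Proof. by apply/corner_proj_deg/gr_deg1. Qed.

Lemma gcorner_fg : finitely_generated gcorner.
Proof.
exists 1%N, (fun=> corner_gen) => x; exists (fun=> val x).
by rewrite big_ord1 -corner_genE.
Qed.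

(** A lift of the image of the generator e can be taken homogeneous of degree 0,
    as degree-preserving maps commute with taking components, and then fixed by
    e. *)
Lemma gcorner_proj : gprojective gcorner.
Proof.
move=> M N g h gs; have [m0 m0P] := gs (h corner_gen).
pose m := ((e : A) : A^c) *: gcomp (gm_grading M) 0 m0.
have gm : g m = h corner_gen.
  rewrite linearZ /= gcomp_hom m0P -gcomp_hom.
  by rewrite (gcomp_id _ _ corner_gen_deg) eqxx -linearZ /= corner_gen_idem.
have m_deg : gm_deg 0 m.
  by rewrite -[0]addr0; apply: gm_degZ => //; apply: (gcompP (gm_grading M)).
have kD (x y : gcorner) : (val (x + y) : A^c) *: m
    = (val x : A^c) *: m + (val y : A^c) *: m.
  by rewrite val_cornerD; apply: scalerDl.
have kZ (a : A) (x : gcorner) : (val ((a : A^c) *: x) : A^c) *: m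
    = (a : A^c) *: ((val x : A^c) *: m).
  by rewrite val_cornerZ rscalerA.
have kdeg n (x : gcorner) : gm_deg n x -> gm_deg n ((val x : A^c) *: m).
  by move=> Hx; rewrite -[n]add0r; apply: gm_degZ.
exists (mkhom kD kZ kdeg) => x.
by rewrite mkhomE linearZ /= gm -linearZ -corner_genE.
Qed.

Definition fgp_corner : fgpModule A := FgpModule gcorner_fg gcorner_proj.

(** An element p of e A is the generator acted on by p = e p, so p (x) b is
    gen (x) f(e) f(p) b, where f(e) = 0. *)
Lemma corner_extend0 (B : gRing) (f : gRingHom A B) : f e = 0 ->
  gmod_iso (gextend f gcorner) (gzero B).
Proof.
move=> fe; have tb := tens_balanced f gcorner.
have ext0 (x : gextend f gcorner) : x = 0.
  elim/tens_ind: x => [//|x y -> ->|p b]; first by rewrite addr0.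
  rewrite [p]corner_genE (balA tb) -(cornerP p) rmorphM fe !mul0r.
  exact: (bal0r _ tb).
have fz n (x : gextend f gcorner) : gm_deg n x -> gm_deg n (0 : gzero B).
  by [].
have gz n (x : gzero B) : gm_deg n x -> gm_deg n (0 : gextend f gcorner).
  by move=> _; apply: grading0 (gm_grading (gextend f gcorner)) n.
exists (@mkhom B _ _ (fun=> 0) (fun _ _ => esym (addr0 _))
  (fun a _ => esym (scaler0 _ _)) fz).
exists (@mkhom B _ _ (fun=> 0) (fun _ _ => esym (addr0 _))
  (fun a _ => esym (scaler0 _ _)) gz).
by split=> x; [rewrite [x]ext0|apply: gzero_eq].
Qed.

End Corner.

(** * Direct finiteness of graded modules over a Leavitt path algebra *)

Section Support.
Variables (A : gRing) (S : gModule A).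

Lemma finitely_generated_homogeneous : finitely_generated S ->
  exists (I : finType) (d : I -> int) (g : I -> S),
    (forall i, gm_deg (d i) (g i)) /\
    forall x, exists a : I -> A, x = \sum_i (a i : A^c) *: g i.
Proof.
move=> [m [g gP]]; have HS := gm_grading S.
exists {i : 'I_m & 'I_(size (gsupp HS (g i)))}.
exists (fun p => tnth (in_tuple (gsupp HS (g (tag p)))) (tagged p)).
exists (fun p => gcomp HS (tnth (in_tuple (gsupp HS (g (tag p)))) (tagged p))
  (g (tag p))); split; first by move=> p; apply: (gcompP HS).
move=> x; have [a ->] := gP x; exists (fun p => a (tag p)).
transitivity (\sum_(i < m) \sum_(j < size (gsupp HS (g i)))
    (a i : A^c) *: gcomp HS (tnth (in_tuple (gsupp HS (g i))) j) (g i)).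
  apply: eq_bigr => i _; rewrite -scaler_sumr; congr (_ *: _).
  by rewrite [LHS](gcomp_sum HS) [LHS]big_tnth.
by rewrite sig_big_dep.
Qed.

Lemma gcompZ n m (x : S) (a : A) : gm_deg m x ->
  gcomp (gm_grading S) n ((a : A^c) *: x)
    = (gcomp (gr_grading A) (n - m) a : A^c) *: x.
Proof.
move=> Hx; pose HS := gm_grading S; pose HA := gr_grading A.
rewrite -/HS -/HA.
have gc0 k : gcomp HS k 0 = 0.
  by rewrite (gcomp_id HS k (grading0 HS 0)); case: eqP.
have gcA0 k : gcomp HA k 0 = 0.
  by rewrite (gcomp_id HA k (grading0 HA 0)); case: eqP.
move: a; apply: (grading_ind HA) => [|a b Ha Hb|k a Ha].
- by rewrite gcA0 !scale0r gc0.
- by rewrite gcompD [_ *: x]scalerDl gcompD Ha Hb [RHS]scalerDl.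
- rewrite (gcomp_id HS n (gm_degZ Hx Ha)) (gcomp_id HA (n - m) Ha) subr_eq.
  by rewrite [k + m]addrC; case: eqP; rewrite ?scale0r.
Qed.

End Support.

Section Finiteness.
Variables (K : fieldType) (E : finGraph).
Local Notation L := (leavitt K E).
Local Notation A := (gunitization L).

Definition utz_in (a : L) : A := (a, 0).

Lemma utz_inM a b : utz_in a * utz_in b = utz_in (nuM a b).
Proof. by congr pair; rewrite /= ?mulr0 // !mulr0z !addr0. Qed.

Lemma utz_inD a b : utz_in (a + b) = utz_in a + utz_in b.
Proof. by congr pair; rewrite /= addr0. Qed.

Lemma utz_in_deg n a : ga_deg n a -> gr_deg n (utz_in a).
Proof. by move=> Ha; split=> //; right. Qed.

Local Notation one := (lpa1 K E : L).

Lemma oneM (a : L) : nuM one a = a. Proof. exact: lpa1l. Qed.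
Lemma Mone (a : L) : nuM a one = a. Proof. exact: lpa1r. Qed.

Lemma one_deg : ga_deg 0 one.
Proof. by apply: (grading_bigsum (ga_grading L)) => v _; apply: LD_vertex. Qed.

Lemma utz_in_ideal (a : A) : utz_in one * a = utz_in (a.1 + one *~ a.2).
Proof.
have -> : utz_in one * a = (nuM one a.1 + a.1 *~ 0 + one *~ a.2, 0 * a.2) by [].
by rewrite oneM mulr0z addr0 mul0r.
Qed.

Lemma utz_in_ideal_comm (a : A) : a * utz_in one = utz_in (a.1 + one *~ a.2).
Proof.
have -> : a * utz_in one = (nuM a.1 one + one *~ a.2 + a.1 *~ 0, a.2 * 0) by [].
by rewrite Mone mulr0z addr0 mulr0.
Qed.

Variable S : gModule A.
Implicit Types (x y : S) (a b : L).

Definition ract x a : S := (utz_in a : A^c) *: x.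

Lemma ractDl x y a : ract (x + y) a = ract x a + ract y a.
Proof. exact: scalerDr. Qed.
Lemma ractDr x a b : ract x (a + b) = ract x a + ract x b.
Proof. by rewrite /ract utz_inD; apply: scalerDl. Qed.
Lemma ractM x a b : ract (ract x a) b = ract x (nuM a b).
Proof. by rewrite /ract rscalerA utz_inM. Qed.
Lemma ract0l a : ract 0 a = 0.
Proof. exact: scaler0. Qed.
Lemma ract_deg m n x a : gm_deg m x -> ga_deg n a -> gm_deg (m + n) (ract x a).
Proof. by move=> Hx Ha; apply: gm_degZ => //; apply: utz_in_deg. Qed.
Lemma ract_suml (I : finType) (F : I -> S) a :
  ract (\sum_i F i) a = \sum_i ract (F i) a.
Proof. exact: (big_morph (ract^~ a) (fun x y => ractDl x y a) (ract0l a)). Qed.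
Definition kact (k : K) x : S := ract x (k *: one).

Lemma kact_ract k x a : kact k (ract x a) = ract x (k *: a).
Proof. by rewrite /kact ractM nuMZr Mone. Qed.

Lemma kactDl k l x : kact (k + l) x = kact k x + kact l x.
Proof. by rewrite /kact scalerDl ractDr. Qed.
Lemma kactDr k x y : kact k (x + y) = kact k x + kact k y.
Proof. exact: ractDl. Qed.
Lemma kactA k l x : kact k (kact l x) = kact (k * l) x.
Proof. by rewrite {2}/kact kact_ract scalerA. Qed.

(** The summand S 1_L is a module over the unital ring L.  Its homogeneous
    generators are indexed by a finite type, and the coefficients of a
    homogeneous element can be replaced by their components of the right
    degree. *)
Lemma unital_homogeneous_generators : finitely_generated S ->
  exists (I : finType) (d : I -> int) (g : I -> S),
  [/\ forall i, gm_deg (d i) (g i), forall i, ract (g i) one = g i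
    & forall n x, gm_deg n x -> ract x one = x -> exists a : I -> L,
      (forall i, ga_deg (n - d i) (a i)) /\ x = \sum_i ract (g i) (a i)].
Proof.
move=> /finitely_generated_homogeneous[I [d [g [gd gP]]]].
exists I, d, (fun i => ract (g i) one); split.
- by move=> i; rewrite -[d i]addr0; apply: ract_deg => //; apply: one_deg.
- by move=> i; rewrite ractM oneM.
move=> n x xn x1; have [a xE] := gP x.
pose c i : A := gcomp (gr_grading A) (n - d i) (a i).
have {}xE : x = \sum_i (c i : A^c) *: g i.
  have := gcomp_id (gm_grading S) n xn; rewrite eqxx => <-; rewrite [in LHS]xE.
  have gc0 : gcomp (gm_grading S) n 0 = 0.
    by rewrite (gcomp_id _ n (grading0 (gm_grading S) 0)); case: eqP.
  rewrite (big_morph _ (gcompD (gm_grading S) n) gc0).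
  by apply: eq_bigr => i _; apply: gcompZ.
exists (fun i => (c i).1 + one *~ (c i).2); split.
  move=> i; suff : gr_deg (n - d i) (utz_in ((c i).1 + one *~ (c i).2)) by case.
  rewrite -utz_in_ideal -[n - d i]add0r; apply: gr_degM.
    exact/utz_in_deg/one_deg.
  exact: (gcompP (gr_grading A)).
rewrite -x1 xE ract_suml; apply: eq_bigr => i _.
by rewrite /ract !rscalerA utz_in_ideal_comm utz_inM oneM.
Qed.

Lemma gmh_ract (u : gModHom S S) x a : u (ract x a) = ract (u x) a.
Proof. exact: linearZ. Qed.

(** A surjective endomorphism that splits has no kernel of degree 0 in S 1_L:
    the element x lies in a finite-dimensional subspace stable under w and its
    section r. *)
Lemma direct_finiteness (w r : gModHom S S) x :
  finitely_generated S -> (forall y, w (r y) = y) ->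
  gm_deg 0 x -> ract x one = x -> w x = 0 -> x = 0.
Proof.
move=> /unital_homogeneous_generators[I [d [g [gd g1 gP]]]] wr x0 x1.
have hom_coef (u : gModHom S S) : exists (c : I -> I -> L) (N : nat),
    (forall i, u (g i) = \sum_j ract (g j) (c i j)) /\
    forall i j (p q : nat), p%:Z - q%:Z = d i - d j -> (N <= q)%N ->
      level p q (c i j).
  have /fin_all_exists[c cP] i : exists a : I -> L,
      (forall j, ga_deg (d i - d j) (a j)) /\ u (g i) = \sum_j ract (g j) (a j).
    by apply: gP; [apply: gmh_deg|rewrite -gmh_ract g1].
  have [N NP] := homogeneous_level_uniform (fun ij : I * I => (cP ij.1).1 ij.2).
  exists c, N; split=> [i|i j]; first by case: (cP i).
  exact: (NP (i, j)).
have [cw [Nw [wE cwP]]] := hom_coef w; have [cr [Nr [rE crP]]] := hom_coef r.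
have [a [a_deg xE]] := gP 0 x x0 x1.
have [Na aP] := homogeneous_level_uniform a_deg.
(* The maximum makes every M - d_i a natural number, and the other summands put
   all these numbers beyond the thresholds for the coefficients of w, r and
   x. *)
pose M := (Nw + Nr + Na + \max_i absz (d i))%N.
have dM i : (absz (d i) <= M)%N.
  by apply: leq_trans (leq_addl _ _); apply: (leq_bigmax i).
pose lev i := absz (M%:Z - d i).
have levE i : (lev i)%:Z = M%:Z - d i by have := dM i; rewrite /lev; lia.
have lev_ge i : (Nw + Nr + Na <= lev i)%N.
  have := leq_bigmax (F := fun i => absz (d i)) i.
  by have := levE i; rewrite /M; lia.
pose gens i := level_gens K E (lev i + M).+1 (lev i) M.
pose s := [seq ract (g i) b | i <- enum I, b <- gens i].
have span (b : I -> L) : (forall i, level (lev i) M (b i)) ->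
    kspan kact (fun y => y \in s) (\sum_i ract (g i) (b i)).
  move=> bP; apply: kspan_sum => i.
  apply: (kspan_map (F := ract (g i)) _ _ _ (level_finite (ltnSn _) (bP i))).
  - exact: ractDr.
  - by move=> k y; rewrite kact_ract.
  - by move=> y ys; apply/allpairsPdep; exists i, y; rewrite mem_enum.
have stable (u : gModHom S S) (c : I -> I -> L) :
    (forall i, u (g i) = \sum_j ract (g j) (c i j)) ->
    (forall i j, level (lev j) (lev i) (c i j)) ->
    forall y, y \in s -> kspan kact (fun z => z \in s) (u y).
  move=> uE cP y /allpairsPdep[i [b [_ /level_gens_level Hb ->]]].
  rewrite gmh_ract uE ract_suml.
  under eq_bigr do rewrite ractM.
  by apply: span => j; apply: levelM Hb.
apply: (kspan_retraction_inj kactDl kactDr kactA (s := s) (r := r)) => //.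
- move=> y /allpairsPdep[i [b [_ _ ->]]].
  by rewrite kact_ract scale1r.
- exact: raddfD.
- by move=> k y; apply: gmh_ract.
- exact: raddfD.
- by move=> k y; apply: gmh_ract.
- apply: stable wE _ => i j.
  by apply: cwP; [rewrite !levE; lia|have := lev_ge i; lia].
- apply: stable rE _ => i j.
  by apply: crP; [rewrite !levE; lia|have := lev_ge i; lia].
- rewrite xE; apply: span => i.
  by apply: aP; [rewrite levE; lia|rewrite /M; lia].
Qed.

End Finiteness.

(** * Classes of projective modules in K-theory *)

Definition K0class (A : gRing) (P : fgpModule A) : K0gr A :=
  @groth_diff (Vgr A) (Vclass P) (abm0 (Vgr A)).

Lemma K0grMap_class0 (A B : gRing) (h : gRingHom A B) (P : fgpModule A) :
  gmod_iso (gextend h P) (gzero B) -> K0grMap h (K0class P) = abg0 (K0gr B).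
Proof.
move=> P0; rewrite /K0grMap /= grothMapE abmh0 /=.
have -> : VgrMap_fun h (Vclass P) = abm0 (Vgr B).
  by rewrite VgrMapE; apply/VclassE.
by [].
Qed.

(** Equality of formal differences is stable isomorphism. *)
Lemma K0class_eq0 (A : gRing) (P : fgpModule A) : K0class P = abg0 (K0gr A) ->
  exists S : fgpModule A, gmod_iso (gsum P S) S.
Proof.
move=> /groth_diffE[s]; rewrite !abm0D [abmD _ (abm0 _)]abmC abm0D.
have [S ->] := VclassP s; rewrite [LHS]VgrDE => /VclassE PS.
by exists S.
Qed.

Lemma vtx_deg (K : fieldType) (E : finGraph) (v : vertex E) :
  ga_deg 0 (vtx K v).
Proof. exact: LD_vertex. Qed.

(** The second projection after G retracts F restricted to S, and it kills the
    image of the generator of v A under F. *)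
Lemma corner_cancel_vtx (K : fieldType) (E : finGraph) (v : vertex E)
    (e := utz_in (vtx K v)) (e_idem : e * e = e) (e_deg : gr_deg 0 e)
    (S : fgpModule (gunitization (leavitt K E))) :
  gmod_iso (gsum (gcorner e_idem e_deg) S) S -> vtx K v = 0.
Proof.
move=> [F [G [FG _]]].
pose P := gcorner e_idem e_deg.
pose q : P := corner_gen e_idem e_deg.
have r_inr y : gmh_comp F (gsum_inr P S) y = F (0, y) by [].
have @pr2 : gModHom (gsum P S) S.
  by apply: (@mkhom _ (gsum P S) S snd) => // n y [].
have pr2E y : pr2 y = y.2 by [].
have q0 : F (q, 0) = 0.
  apply: (direct_finiteness (w := gmh_comp pr2 G) (r := gmh_comp F (gsum_inr P S))).
  - exact: fgp_fg.
  - by move=> y; rewrite r_inr mkhomE FG.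
  - apply: gmh_deg; split; first exact: corner_gen_deg.
    exact: grading0 (gm_grading S) 0.
  - rewrite /ract -linearZ; congr (F _); congr pair; last exact: scaler0.
    apply: val_inj; rewrite val_cornerZ /= mulr1 utz_inM.
    by rewrite Mone.
  - by rewrite mkhomE FG.
have : q = 0.
  have : G (F (q, 0)) = 0 by rewrite q0 raddf0.
  by rewrite FG => /(congr1 fst).
move=> /(congr1 val); rewrite val_corner0 /= mulr1.
by case.
Qed.

Theorem theorem5p6 (K : fieldType) (E : finGraph) (R : gAlgebra K)
    (f : gAlgHom (leavitt K E) R) :
  injective (K0gr_nuMap f) -> injective f.
Proof.
move=> K0_inj; apply: graded_uniqueness => v fv.
pose e := utz_in (vtx K v).
have e_idem : e * e = e by rewrite utz_inM vtxM eqxx.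
have e_deg : gr_deg 0 e by apply/utz_in_deg/vtx_deg.
pose P := fgp_corner e_idem e_deg.
have aug0 : K0grMap (utz_aug (leavitt K E)) (K0class P) = abg0 _.
  by apply: K0grMap_class0; apply: corner_extend0.
have f0 : K0grMap (utz_map f) (K0class P) = abg0 _.
  by apply/K0grMap_class0/corner_extend0; congr pair.
have P0 : Ker aug0 = ker0 _.
  apply: K0_inj; apply: ker_val_inj.
  exact: etrans f0 (esym (abgh0 (K0grMap (utz_map f)))).
have [S PS] := K0class_eq0 (congr1 (@ker_val _ _ _) P0).
exact: corner_cancel_vtx PS.
Qed.
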